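(* Let $a\in(-\infty,-1]$ and $f_a(z)=e^z+a$. Then $F(f_a)\cup I(f_a)$ is path-connected.
   Context: For $a\in\mathbb C$ let $f_a:\mathbb C\to\mathbb C$, $f_a(z)=e^z+a$, and let $f_a^n$ denote its $n$-fold iterate. $F(f_a)$ is the Fatou set of $f_a$, and $I(f_a)=\{z\in\mathbb C: f_a^n(z)\to\infty\}$ is the escaping set. The set $F(f_a)\cup I(f_a)$ carries the subspace topology from $\mathbb C$. *)

(* Defs.v *)
From HB Require Import structures.
From mathcomp Require Import all_boot all_order all_algebra.
From mathcomp Require Import all_classical all_reals all_analysis.
From mathcomp Require Import complex.

Set Implicit Arguments.
Unset Strict Implicit.
Unset Printing Implicit Defensive.

Import Order.TTheory GRing.Theory Num.Theory.
Import numFieldNormedType.Exports.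

Local Open Scope classical_set_scope.
Local Open Scope ring_scope.
Local Open Scope complex_scope.

(* The topology, uniformity and norm of C = R[i] as a normed field; the norm
   takes its (real) values in R[i] itself. *)
HB.instance Definition _ (R : realType) :=
  PseudoPointedMetric.copy R[i] R[i]^o.
HB.instance Definition _ (R : realType) := NormedModule.copy R[i] R[i]^o.

Section ComplexDynamics.
Context {R : realType}.
Local Notation C := R[i].

Definition cexp (z : C) : C :=
  (expR (complex.Re z) * cos (complex.Im z))
    +i* (expR (complex.Re z) * sin (complex.Im z)).

Definition f_exp (a z : C) : C := cexp z + a.

Definition locally_uniform_cvg (U : set C) (h : nat -> C -> C) (g : C -> C) :=
  {family [set K | compact K /\ K `<=` U], h @ \oo --> g}.

(* The bound M is a real number, embedded in C for comparison with the norm. *)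
Definition locally_uniform_cvg_infty (U : set C) (h : nat -> C -> C) :=
  forall K : set C, compact K -> K `<=` U ->
  forall M : R, \forall n \near \oo, forall z, K z -> M%:C < `|h n z|.

(* Montel normality for a family of holomorphic functions on a domain U;
   on a connected open set a locally uniform limit in the Riemann sphere is
   either finite everywhere or identically infinite. *)
Definition normal_family (U : set C) (F : set (C -> C)) :=
  forall h : nat -> C -> C, (forall n, F (h n)) ->
  exists phi : nat -> nat, {homo phi : m n / (m < n)%N} /\
    ((exists g : C -> C, locally_uniform_cvg U (h \o phi) g) \/
     locally_uniform_cvg_infty U (h \o phi)).

Definition iterates (f : C -> C) : set (C -> C) :=
  range (fun n : nat => iter n f).

Definition Fatou_set (f : C -> C) : set C :=
  [set z | exists U : set C,
     [/\ open U, connected U, U z & normal_family U (iterates f)]].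

Definition escaping_set (f : C -> C) : set C :=
  [set z | `|iter n f z| @[n --> \oo] --> +oo].

(* Continuity into A for the subspace topology is continuity into T together
   with the image being contained in A. *)
Definition path_connected {T : topologicalType} (A : set T) :=
  forall x y : T, A x -> A y ->
  exists gamma : R -> T,
    [/\ {within `[0, 1], continuous gamma}, gamma 0 = x, gamma 1 = y
      & forall t, t \in `[0, 1] -> A (gamma t)].

End ComplexDynamics.
Arguments path_connected R {T} A.

(* Main.v *)
Require Import Defs.
From mathcomp Require Import all_boot all_order all_algebra.
From mathcomp Require Import all_classical all_reals all_analysis.
From mathcomp Require Import complex ring lra.
Import Order.TTheory GRing.Theory Num.Theory.
Import numFieldNormedType.Exports.
Local Open Scope classical_set_scope.
Local Open Scope ring_scope.
Local Open Scope complex_scope.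

Set Implicit Arguments.
Unset Strict Implicit.
Unset Printing Implicit Defensive.

(* Let B be the set of points whose orbit enters the half-plane Re < 0. Since f maps that
   half-plane into the disc D(a, 1), on which it contracts, B is an open subset of the Fatou
   set; it is dense because inverse branches contract the half-plane Re >= 0, and it is
   path-connected because paths in Re > a lift through inverse branches. As the horizontal lines
   whose height is an odd multiple of pi lie in B, it remains to join a point z of I \ B to B.

   The point z may lie in the interior of a hair, so a path to it has to cross other hairs
   without meeting their non-escaping endpoints. Such a curve is the image of a vertical line
   under a semiconjugacy from a "square exponential", which maps vertical segments to squares
   with horizontal sides in B: a point of the line which never meets a horizontal or left side
   stays on vertical lines further and further right, and so its image escapes.
   Joining, near each point f^m(z) of the orbit, a point of B to the next one along such curves
   and pulling back by f^m gives paths in B and I that shrink to z. *)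

(** * The complex exponential and logarithm *)

Section ComplexBasics.
Context {R : realType}.
Local Notation C := R[i].
Implicit Types (z w : C) (x y r : R).
Local Notation re := (@complex.Re R).
Local Notation im := (@complex.Im R).

(** The value [a = -1] dictates the form of the estimates: 0 is then a parabolic fixed point on the
    line re = 0, where the disc D(a, 1) touches that line, and neither [f] on the disc nor its
    inverse branches on the half-plane contract uniformly. Both contractions are therefore stated
    for pairs of points at distance at least a given bound, with a factor depending on that bound. A
    pair of orbits closer than the bound is harmless, because nothing expands. The square
    exponential faces another obstacle: the sides of the squares must lie at odd multiples of pi,
    and the exponential of such a number is in general not one. So the abscissas form a sequence
    [c n] with [c n.+1] only close to [expR (c n)], the square exponential changes with the level
    [n], and the semiconjugacy is a sequence of maps, each obtained from the next by a lift. *)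

Definition abs z : R := Normc.normc z.
Arguments abs : simpl never.

Lemma normE z : `|z| = (abs z)%:C. Proof. by []. Qed.

Lemma abs_ge0 z : 0 <= abs z.
Proof. by case: z => x y; rewrite /abs /= sqrtr_ge0. Qed.

Lemma abs_sqr z : abs z ^+ 2 = re z ^+ 2 + im z ^+ 2.
Proof. by case: z => x y; rewrite /abs /= sqr_sqrtr ?addr_ge0 ?sqr_ge0. Qed.

Lemma absM z w : abs (z * w) = abs z * abs w.
Proof. exact: Normc.normcM. Qed.

Lemma abs_tri z w : abs (z + w) <= abs z + abs w.
Proof. exact: (@le_normcD R). Qed.

Lemma absN z : abs (- z) = abs z.
Proof. exact: (@normcN R). Qed.

Lemma abs0 : abs 0 = 0.
Proof. exact: Normc.normc0. Qed.

Lemma absB z w : abs (z - w) = abs (w - z).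
Proof. by rewrite -absN opprB. Qed.

Lemma abs_dist z w u : abs (z - u) <= abs (z - w) + abs (w - u).
Proof. by have := abs_tri (z - w) (w - u); rewrite addrA subrK. Qed.

Lemma abs_eq0 z : abs z = 0 -> z = 0.
Proof. exact: Normc.eq0_normc. Qed.

Lemma abs_real x : abs x%:C = `|x|.
Proof. by rewrite /abs /= expr0n /= addr0 sqrtr_sqr. Qed.

Lemma reD z w : re (z + w) = re z + re w. Proof. by case: z w => ? ? []. Qed.
Lemma imD z w : im (z + w) = im z + im w. Proof. by case: z w => ? ? []. Qed.
Lemma reN z : re (- z) = - re z. Proof. by case: z. Qed.
Lemma imN z : im (- z) = - im z. Proof. by case: z. Qed.
Lemma reM z w : re (z * w) = re z * re w - im z * im w.
Proof. by case: z w => ? ? []. Qed.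
Lemma imM z w : im (z * w) = re z * im w + im z * re w.
Proof. by case: z w => ? ? []. Qed.

Definition reimE := (reD, imD, reN, imN).

Lemma complex_ext z w : re z = re w -> im z = im w -> z = w.
Proof. by case: z w => ? ? [? ?] /= -> ->. Qed.

Lemma abs_re z : `|re z| <= abs z.
Proof.
rewrite -(ler_pXn2r (n := 2)) ?nnegrE ?abs_ge0 ?normr_ge0//.
by rewrite abs_sqr real_normK ?num_real// lerDl sqr_ge0.
Qed.

Lemma abs_im z : `|im z| <= abs z.
Proof.
rewrite -(ler_pXn2r (n := 2)) ?nnegrE ?abs_ge0 ?normr_ge0//.
by rewrite abs_sqr real_normK ?num_real// lerDr sqr_ge0.
Qed.

Lemma abs_le z : abs z <= `|re z| + `|im z|.
Proof.
rewrite -(ler_pXn2r (n := 2)) ?nnegrE ?abs_ge0 ?addr_ge0//.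
rewrite abs_sqr sqrrD !real_normK ?num_real//.
rewrite [X in _ <= X]addrAC lerDl.
by rewrite mulrn_wge0 ?mulr_ge0.
Qed.

Lemma abs_le_sqr z r : 0 <= r -> re z ^+ 2 + im z ^+ 2 <= r ^+ 2 -> abs z <= r.
Proof. by move=> r0; rewrite -abs_sqr ler_pXn2r ?nnegrE ?abs_ge0. Qed.

Lemma cexpE z : re (cexp z) = expR (re z) * cos (im z). Proof. by []. Qed.
Lemma cexpEi z : im (cexp z) = expR (re z) * sin (im z). Proof. by []. Qed.

Lemma cexpD z w : cexp (z + w) = cexp z * cexp w.
Proof.
apply: complex_ext; rewrite ?reM ?imM !cexpE !cexpEi reD imD expRD.
  by rewrite cosD; ring.
by rewrite sinD; ring.
Qed.

Lemma cexp0 : cexp 0 = 1 :> C.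
Proof.
by apply: complex_ext; rewrite /= expR0 ?cos0 ?sin0 ?mulr1 ?mulr0.
Qed.

Lemma cexp_real x : cexp x%:C = (expR x)%:C.
Proof. by rewrite /cexp /= cos0 sin0 mulr1 mulr0. Qed.

Lemma abs_cexp z : abs (cexp z) = expR (re z).
Proof.
apply/eqP; rewrite -(eqrXn2 (n := 2)) ?abs_ge0 ?expR_ge0//; apply/eqP.
by rewrite abs_sqr cexpE cexpEi !exprMn -mulrDr cos2Dsin2 mulr1.
Qed.

Lemma cexp_neq0 z : cexp z != 0.
Proof.
by apply/eqP => h; have := abs_cexp z; rewrite h abs0 => /esym/eqP; rewrite expR_eq0.
Qed.

Lemma sin_le_id x : 0 <= x -> sin x <= x.
Proof.
move=> x0; have [c _] : exists2 c, c \in `[0, x] &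
    (fun t => t - sin t) x - (fun t => t - sin t) 0 = (1 - cos c) * (x - 0).
  apply: (@MVT_segment _ (fun t => t - sin t) (fun t => 1 - cos t)) => //.
  apply: continuous_subspaceT => t.
  by apply: continuousB; [exact: cvg_id|exact: continuous_sin].
by rewrite sin0 !subr0 => h; rewrite -subr_ge0 h mulr_ge0// subr_ge0.
Qed.

Lemma cos_ge_quad x : 1 - x ^+ 2 / 2 <= cos x.
Proof.
wlog x0 : x / 0 <= x => [h|].
  have [/h//|/ltW xlt] := leP 0 x.
  by have := h (- x); rewrite cosN sqrrN oppr_ge0 => /(_ xlt).
have -> : cos x = 1 - 2 * sin (x / 2) ^+ 2.
  have {1}-> : x = (x / 2) *+ 2 by rewrite mulr2n; field.
  by rewrite cos_mulr2n cos2sin2 mulr2n; ring.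
have [s s0] : exists2 s, s = `|sin (x / 2)| & 0 <= s <= x / 2.
  exists `|sin (x / 2)| => //; rewrite normr_ge0 /=.
  have x20 : 0 <= x / 2 by rewrite divr_ge0.
  have [sp|/ltW sn] := leP 0 (sin (x / 2)).
    by rewrite ger0_norm// sin_le_id.
  have [x2|x2] := leP (x / 2) 1; last first.
    by rewrite (le_trans (sin_max _)) // ltW.
  rewrite (_ : `| _ | = 0) //; apply/eqP; rewrite normr_eq0 eq_le sn /=.
  by rewrite sin_ge0_pi// x20 (le_trans x2)//; have := @pi_ge2 R; lra.
move=> /andP[s1 s2].
rewrite -(real_normK (num_real (sin (x / 2)))) -s0.
nra.
Qed.

(** The squared modulus splits as [(1 - e) ^+ 2 + 2 * e * (1 - cos y)] with [e = expR x <= 1]; the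
    two terms are at most [x ^+ 2] and [y ^+ 2]. *)
Lemma cexp_sub1_le z : re z <= 0 -> abs (cexp z - 1) <= abs z.
Proof.
case: z => x y /= x0; apply: abs_le_sqr; first exact: abs_ge0.
rewrite abs_sqr !reimE /= subr0.
have h1 := expR_ge1Dx x; have h2 := expR_gt0 x.
have h3 : expR x <= 1 by rewrite expR_le1.
have h4 := cos_ge_quad y; have h5 := cos2Dsin2 y.
set e := expR x in h1 h2 h3 *; set c := cos y in h4 h5 *; set s := sin y in h5 *.
have -> : (e * c - 1) ^+ 2 + (e * s) ^+ 2 = (1 - e) ^+ 2 + 2 * e * (1 - c).
  have -> : (e * c - 1) ^+ 2 + (e * s) ^+ 2 = e ^+ 2 * (c ^+ 2 + s ^+ 2) - 2 * e * c + 1.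
    by ring.
  by rewrite h5; ring.
apply: lerD.
  by rewrite -(sqrrN x) ler_pXn2r ?nnegrE ?oppr_ge0 ?subr_ge0//; lra.
have h6 : 2 * e * (1 - c) <= 2 * e * (y ^+ 2 / 2).
  by apply: ler_wpM2l; [rewrite mulr_ge0// ltW|lra].
by apply: (le_trans h6); have := ler_wpM2r (sqr_ge0 y) h3; lra.
Qed.

Lemma cexp_lip (m : R) z w : re z <= m -> re w <= m ->
  abs (cexp z - cexp w) <= expR m * abs (z - w).
Proof.
wlog h : z w / re z <= re w => [hw zm wm|].
  have [/hw->//|/ltW /hw h] := leP (re z) (re w).
  by rewrite absB (absB z); apply: h.
move=> _ wm; have -> : cexp z - cexp w = cexp w * (cexp (z - w) - 1).
  by rewrite mulrBr mulr1 -cexpD [w + _]addrC subrK.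
rewrite absM abs_cexp ler_pM ?abs_ge0 ?expR_ge0 ?ler_expR//.
by apply: cexp_sub1_le; rewrite !reimE subr_le0.
Qed.

(* An inverse of [cexp] on the right half-plane only. *)
Definition clog z : C := (ln (abs z)) +i* atan (im z / re z).

Lemma re_clog z : re (clog z) = ln (abs z). Proof. by []. Qed.

Lemma clogK z : 0 < re z -> cexp (clog z) = z.
Proof.
case: z => u v /= u0; have u1 : u != 0 by rewrite gt_eqF.
have az : 0 < abs (u +i* v).
  by apply: lt_le_trans (abs_re _); rewrite normr_gt0.
have e : abs (u +i* v) = u * Num.sqrt (1 + (v / u) ^+ 2).
  apply/eqP; rewrite -(eqrXn2 (n := 2)) ?abs_ge0 ?mulr_ge0 ?sqrtr_ge0 ?ltW//.
  rewrite abs_sqr exprMn sqr_sqrtr ?addr_ge0 ?sqr_ge0//=.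
  by apply/eqP; field.
have s0 : Num.sqrt (1 + (v / u) ^+ 2) != 0.
  by rewrite sqrtr_eq0 -ltNge ltr_wpDr// sqr_ge0.
apply: complex_ext; rewrite /= lnK ?posrE// e.
  by rewrite cos_atan -mulrA mulfV ?mulr1.
have ct : cos (atan (v / u)) != 0 by rewrite cos_atan invr_eq0.
have -> : sin (atan (v / u)) = tan (atan (v / u)) * cos (atan (v / u)).
  by rewrite /tan mulrVK ?unitfE.
rewrite atanK cos_atan; move: (Num.sqrt _) s0 => s s0.
by rewrite mulrA -[u * s * _]mulrA [s * _]mulrC mulrA [u * _]mulrC divfK// mulfK//.
Qed.

Lemma clog_im_bound z : - (pi / 2) < im (clog z) < pi / 2.
Proof. by rewrite /= atan_gtNpi2 atan_ltpi2. Qed.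

End ComplexBasics.

(** * Lipschitz estimates for the logarithm *)

Section ComplexLog.
Context {R : realType}.
Local Notation C := R[i].
Implicit Types (z w : C) (x y r : R).
Local Notation re := (@complex.Re R).
Local Notation im := (@complex.Im R).

Lemma is_derive_affine (u v t : R) : is_derive t 1 (fun s : R => u + s * v) v.
Proof.
have h := is_deriveD (is_derive_cst u t 1) (is_deriveM (is_derive_id t 1) (is_derive_cst v t 1)).
apply: is_derive_eq h _ => /=.
by rewrite add0r scaler0 add0r /GRing.scale/= mulr1.
Qed.
(** The function is the real inner product of [a + i b] with the logarithm along a segment, which
    reduces estimates on [clog] to the real mean value theorem. *)
Lemma is_derive_log_arg (a b u v u' v' t : R) : 0 < u + t * u' ->
  is_derive t 1 (fun s => a * (ln ((u + s * u') ^+ 2 + (v + s * v') ^+ 2) / 2) + b * atan ((v + s * v') / (u + s * u')))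
   ((a * ((u + t * u') * u' + (v + t * v') * v') + b * ((u + t * u') * v' - (v + t * v') * u')) / ((u + t * u') ^+ 2 + (v + t * v') ^+ 2)).
Proof.
move=> U0.
have hU := is_derive_affine u u' t.
have hV := is_derive_affine v v' t.
set U := fun s => u + s * u'; set V := fun s => v + s * v'.
have Q0 : 0 < U t ^+ 2 + V t ^+ 2 by rewrite ltr_pwDl ?exprn_gt0 ?sqr_ge0.
pose Q := fun s => U s ^+ 2 + V s ^+ 2.
have hQ : is_derive t 1 Q ((2 * (u + t * u') ^+ 2.-1) *: u' + (2 * (v + t * v') ^+ 2.-1) *: v').
  exact: is_deriveD (is_deriveX 2 hU) (is_deriveX 2 hV).
have hl := @is_derive1_comp R (@ln R) Q t _ _ (is_derive1_ln Q0) hQ.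
have U1 : U t != 0 by rewrite gt_eqF.
have hUi := is_deriveV U1 hU.
have hW := is_deriveM hV hUi.
have ha := @is_derive1_comp R (@atan R) (fun s => V s / U s) t _ _ (is_derive1_atan (V t / U t)) hW.
have h := is_deriveD (is_deriveZ (a / 2) hl) (is_deriveZ b ha).
have e : (fun s => a * (ln ((u + s * u') ^+ 2 + (v + s * v') ^+ 2) / 2) + b * atan ((v + s * v') / (u + s * u')))
 = (a / 2) \*: (@ln R \o Q) + b \*: (@atan R \o (fun s => V s / U s)).
  by apply/funext => s; rewrite /= !fctE /= /GRing.scale /=; congr (_ + _); rewrite mulrA mulrAC.
rewrite e; eapply is_derive_eq; first exact: h.
rewrite /= /GRing.scale /=.
have Q1 : (u + t * u') ^+ 2 + (v + t * v') ^+ 2 != 0 by rewrite gt_eqF.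
have {}U1 : u + t * u' != 0 by exact: U1.
rewrite /U /V; move: (u + t * u') (v + t * v') U1 Q1 => A B A0 Q1.
field.
by rewrite A0 Q1.
Qed.

Lemma ln_abs z : 0 < abs z -> ln (abs z) = ln (re z ^+ 2 + im z ^+ 2) / 2.
Proof.
by move=> h; rewrite -abs_sqr lnXn// -[_ *+ 2]mulr_natr mulfK.
Qed.

(** Mean value theorem for the inner product [phi] of [D = clog z - clog w] with [clog] along the
    segment: [phi 1 - phi 0] is the square of [abs D], and the derivative is at most
    [abs D * abs d / m]. *)
Lemma clog_lip (m : R) z w : 0 < m -> 0 < re z -> 0 < re w ->
    (forall t : R, 0 <= t <= 1 -> m <= abs (w + t%:C * (z - w))) ->
  abs (clog z - clog w) <= abs (z - w) / m.
Proof.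
move=> m0 z0 w0 hm.
have az : 0 < abs z by apply: lt_le_trans (abs_re _); rewrite normr_gt0 gt_eqF.
have aw : 0 < abs w by apply: lt_le_trans (abs_re _); rewrite normr_gt0 gt_eqF.
set D := clog z - clog w; set d := z - w.
pose phi (s : R) : R := re D * (ln ((re w + s * re d) ^+ 2 + (im w + s * im d) ^+ 2) / 2)
  + im D * atan ((im w + s * im d) / (re w + s * re d)).
have pos (t : R) : 0 <= t <= 1 -> 0 < re w + t * re d.
  move=> /andP[t0 t1]; rewrite /d !reimE.
  have -> : re w + t * (re z - re w) = (1 - t) * re w + t * re z by ring.
  have [->|tn0] := eqVneq t 0; first by rewrite subr0 mul1r mul0r addr0.
  apply: ltr_wpDl; first by apply: mulr_ge0; [rewrite subr_ge0|exact: ltW].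
  by rewrite mulr_gt0// lt0r tn0.
pose dphi (t : R) : R := (re D * ((re w + t * re d) * re d + (im w + t * im d) * im d)
  + im D * ((re w + t * re d) * im d - (im w + t * im d) * re d))
  / ((re w + t * re d) ^+ 2 + (im w + t * im d) ^+ 2).
have phiD (t : R) : 0 <= t <= 1 -> is_derive t 1 phi (dphi t).
  by move=> /pos; exact: is_derive_log_arg.
have [t t01] : exists2 t, t \in `[0, 1] & phi 1 - phi 0 = dphi t * (1 - 0).
  apply: MVT_segment; first exact: ler01.
    by move=> t /itvP t01; apply: phiD; rewrite !t01.
  apply: derivable_within_continuous => t; rewrite in_itv => /phiD h.
  by case: h.
rewrite subr0 mulr1.
have -> : phi 1 - phi 0 = abs D ^+ 2.
  rewrite abs_sqr /phi !mul1r !mul0r !addr0.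
  have -> : re w + re d = re z by rewrite /d !reimE; ring.
  have -> : im w + im d = im z by rewrite /d !reimE; ring.
  by rewrite -!ln_abs// /D !reimE /=; ring.
rewrite /dphi; set U := re w + t * re d; set V := im w + t * im d => hD.
have {}t01 : 0 <= t <= 1 by rewrite in_itv in t01.
have rho2 : abs (w + t%:C * d) ^+ 2 = U ^+ 2 + V ^+ 2.
  rewrite abs_sqr /U /V; generalize d => e.
  by congr (_ ^+ 2 + _ ^+ 2); rewrite !(reimE, reM, imM) /=; ring.
have {hm} := hm _ t01; rewrite -/d; set rho := abs _ in rho2 * => hm.
have r0 : 0 < rho by apply: lt_le_trans hm.
rewrite ler_pdivlMr//.
apply: (@le_trans _ _ (abs D * rho)); first by rewrite ler_wpM2l ?abs_ge0.
have [D0|Dn0] := eqVneq (abs D) 0; first by rewrite D0 mul0r abs_ge0.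
have D0 : 0 < abs D by rewrite lt0r Dn0 abs_ge0.
rewrite -(ler_pXn2r (n := 2)) ?nnegrE ?mulr_ge0 ?abs_ge0 ?(ltW r0)//.
rewrite -(ler_pM2l (mulr_gt0 (exprn_gt0 2 D0) (exprn_gt0 2 r0))).
have -> : abs D ^+ 2 * rho ^+ 2 * (abs D * rho) ^+ 2 = (abs D ^+ 2 * rho ^+ 2) ^+ 2 by ring.
rewrite {1}hD rho2 divfK; last by rewrite -rho2 expf_neq0// gt_eqF.
rewrite !abs_sqr -/d -subr_ge0.
(* Lagrange's identity: the two sides of the Cauchy-Schwarz inequality differ by this square. *)
have := sqr_ge0 (re D * (U * im d - V * re d) - im D * (U * re d + V * im d)).
congr (_ <= _); ring.
Qed.

Lemma clog_lip_re (m : R) z w : 0 < m -> m <= re z -> m <= re w ->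
  abs (clog z - clog w) <= abs (z - w) / m.
Proof.
move=> m0 mz mw; apply: clog_lip => //; try exact: lt_le_trans m0 _.
move=> t /andP[t0 t1]; 
apply: le_trans (abs_re _); apply: le_trans (ler_norm _).
rewrite !(reimE, reM) /= mul0r subr0.
have -> : re w + t * (re z - re w) = (1 - t) * re w + t * re z by ring.
have -> : m = (1 - t) * m + t * m by ring.
by apply: lerD; apply: ler_wpM2l; rewrite ?subr_ge0.
Qed.

End ComplexLog.

(** * Paths and limits of paths *)

Section Topology.
Context {R : realType}.
Local Notation C := R[i].
Implicit Types (z w : C) (x y r : R) (A : set C).
Local Notation re := (@complex.Re R).
Local Notation im := (@complex.Im R).

Lemma real_gt0 (e : C) : 0 < e -> e = (re e)%:C /\ 0 < re e.
Proof. by case: e => a b; rewrite ltcE /= => /andP[/eqP -> a0]. Qed.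

Lemma cvgC_abs (T : Type) (F : set_system T) {FF : Filter F} (f : T -> C) z :
  f t @[t --> F] --> z <-> forall e : R, 0 < e -> \forall t \near F, abs (z - f t) < e.
Proof.
split=> [/cvgrPdist_lt h e e0|h].
  have := h e%:C; rewrite ltcR => /(_ e0); apply: filterS => t.
  by rewrite normE ltcR.
apply/cvgrPdist_lt => e /real_gt0[-> e0].
by apply: filterS (h _ e0) => t; rewrite normE ltcR.
Qed.

Lemma continuous_re : continuous re.
Proof.
move=> z; apply/(@cvgrPdist_lt _ _ _ _ (nbhs_filter z)) => e e0.
have := (@cvgC_abs _ _ (nbhs_filter z) id z).1 (@cvg_id _ _) e e0.
apply: filterS => w; apply: le_lt_trans.
by rewrite -reN -reD abs_re.
Qed.

Lemma continuous_im : continuous im.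
Proof.
move=> z; apply/(@cvgrPdist_lt _ _ _ _ (nbhs_filter z)) => e e0.
have := (@cvgC_abs _ _ (nbhs_filter z) id z).1 (@cvg_id _ _) e e0.
apply: filterS => w; apply: le_lt_trans.
by rewrite -imN -imD abs_im.
Qed.

Lemma continuous_complex (T : topologicalType) (f : T -> C) t :
  {for t, continuous (fun s => re (f s))} -> {for t, continuous (fun s => im (f s))} ->
  {for t, continuous f}.
Proof.
move=> /cvgrPdist_lt hr /cvgrPdist_lt hi; apply/cvgC_abs => e e0.
have e2 : 0 < e / 2 by rewrite divr_gt0.
apply: filterS2 (hr _ e2) (hi _ e2) => s h1 h2.
apply: le_lt_trans (abs_le _) _; rewrite !reimE [e]splitr.
exact: ltrD.
Qed.

Lemma abs_dist_abs z w : `|abs z - abs w| <= abs (z - w).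
Proof.
have h1 := abs_tri (z - w) w; have h2 := abs_tri (w - z) z.
by rewrite subrK in h1; rewrite subrK absB in h2; rewrite ler_norml; lra.
Qed.

Lemma continuous_abs (T : topologicalType) (f : T -> C) t :
  {for t, continuous f} -> {for t, continuous (fun s => abs (f s))}.
Proof.
move=> /cvgC_abs h; apply/cvgrPdist_lt => e /h; apply: filterS => s.
by apply: le_lt_trans; exact: abs_dist_abs.
Qed.

Lemma continuousCD (T : topologicalType) (f g : T -> C) t :
  {for t, continuous f} -> {for t, continuous g} ->
  {for t, continuous (fun s => f s + g s)}.
Proof. exact: (@continuousD R[i] R[i] T f g t). Qed.

Lemma continuousCM (T : topologicalType) (f g : T -> C) t :
  {for t, continuous f} -> {for t, continuous g} ->
  {for t, continuous (fun s => f s * g s)}.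
Proof. exact: (@continuousM R[i] T f g t). Qed.

Lemma continuous_cexp : continuous (@cexp R).
Proof.
move=> z; apply: continuous_complex => /=; apply: continuousM.
- by apply: continuous_comp; [exact: continuous_re|exact: continuous_expR].
- by apply: continuous_comp; [exact: continuous_im|exact: continuous_cos].
- by apply: continuous_comp; [exact: continuous_re|exact: continuous_expR].
- by apply: continuous_comp; [exact: continuous_im|exact: continuous_sin].
Qed.

Lemma continuous_clog z : 0 < re z -> {for z, continuous (@clog R)}.
Proof.
move=> z0; apply: continuous_complex => /=.
  apply: (@continuous_comp _ _ _ abs (@ln R)).
    by apply: continuous_abs; exact: cvg_id.
  by apply: continuous_ln; apply: lt_le_trans (abs_re _); rewrite normr_gt0 gt_eqF.
apply: (@continuous_comp _ _ _ (fun w => im w / re w) (@atan R)); last exact: continuous_atan.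
apply: continuousM; first exact: continuous_im.
by apply: continuousV; [rewrite gt_eqF|exact: continuous_re].
Qed.

Lemma half_expn_le (k : nat) : k.+1%:R * (2^-1 : R) ^+ k <= 1.
Proof.
elim: k => [|k IH]; first by rewrite expr0 mulr1.
have h : (2^-1 : R) ^+ k >= 0 by rewrite exprn_ge0.
have k0 : (0 : R) <= k%:R by [].
rewrite exprS; move: IH h; set u := _ ^+ k; rewrite -[k.+2%:R]natr1 -[k.+1%:R]natr1 => IH h.
by have := mulr_ge0 k0 h; lra.
Qed.

Lemma half_expn_lt (K e : R) : 0 < e -> exists k, K * 2^-1 ^+ k < e.
Proof.
move=> e0; set b := `|K| / e.
have /archi_boundP hb : 0 <= b by rewrite divr_ge0// ltW.
exists (Num.bound b); set n := Num.bound b in hb *.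
apply: le_lt_trans (_ : `|K| * 2^-1 ^+ n < e).
  by rewrite ler_wpM2r ?ler_norm// exprn_ge0.
have h := half_expn_le n; have u0 : (2^-1 : R) ^+ n > 0 by rewrite exprn_gt0.
have : `|K| < n.+1%:R * e.
  rewrite -ltr_pdivrMr//; apply: lt_trans hb _; by rewrite ltr_nat.
set u := _ ^+ n in u0 h *; move: (n.+1%:R) h => N h; nra.
Qed.

Lemma le_half_lim (K x y : R) : (forall k, x <= y + K * 2^-1 ^+ k) -> x <= y.
Proof.
move=> h; rewrite leNgt; apply/negP => yx.
have e0 : 0 < x - y by rewrite subr_gt0.
have [k] := half_expn_lt K e0.
by rewrite ltrBrDl ltNge h.
Qed.

(* [sup (u k - 2 K / 2^k)] is the limit: the sequences [u k -+ 2 K / 2^k] are monotone. *)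
Lemma geometric_limit (K : R) (u : nat -> R) :
  (forall k, `|u k.+1 - u k| <= K * 2^-1 ^+ k) ->
  exists l, forall k, `|l - u k| <= 2 * K * 2^-1 ^+ k.
Proof.
move=> h; pose a k := u k - 2 * K * 2^-1 ^+ k; pose b k := u k + 2 * K * 2^-1 ^+ k.
have K0 k : 0 <= K * 2^-1 ^+ k by apply: le_trans (h k); exact: normr_ge0.
have aS k : a k <= a k.+1 /\ b k.+1 <= b k.
  have := h k; rewrite ler_norml /a /b exprS; lra.
have aD k n : a k <= a (k + n)%N /\ b (k + n)%N <= b k.
  elim: n => [|n [h1 h2]]; first by rewrite addn0.
  by rewrite addnS; have [h3 h4] := aS (k + n)%N; split; apply: le_trans; eauto.
have ab k n : a k <= b n.
  have [h1 _] := aD k n; have [_ h2] := aD n k.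
  apply: le_trans h1 (le_trans _ h2); rewrite addnC /a /b.
  by have := K0 (n + k)%N; lra.
have hs : has_sup (range a).
  by split; [exists (a 0%N), 0%N|exists (b 0%N) => _ [k _ <-]].
exists (sup (range a)) => k; rewrite ler_norml.
have h1 : a k <= sup (range a) by apply: (ub_le_sup hs.2); exists k.
have h2 : sup (range a) <= b k by apply: ge_sup; [exact: hs.1|move=> _ [n _ <-]].
by rewrite /a in h1; rewrite /b in h2; lra.
Qed.

Lemma geometric_limit_continuous (T : topologicalType) (K : R) (F : nat -> T -> C) :
  (forall k, continuous (F k)) ->
  (forall k (x : T), abs (F k.+1 x - F k x) <= K * 2^-1 ^+ k) ->
  exists2 G : T -> C, continuous G &
    forall k (x : T), abs (G x - F k x) <= 4 * K * 2^-1 ^+ k.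
Proof.
move=> cF hF.
have hr (x : T) : exists l, forall k, `|l - re (F k x)| <= 2 * K * 2^-1 ^+ k.
  apply: geometric_limit => k; apply: le_trans (hF k x).
  by rewrite -reN -reD abs_re.
have hi (x : T) : exists l, forall k, `|l - im (F k x)| <= 2 * K * 2^-1 ^+ k.
  apply: geometric_limit => k; apply: le_trans (hF k x).
  by rewrite -imN -imD abs_im.
have [u hu] := choice hr; have [v hv] := choice hi.
pose G (x : T) : C := u x +i* v x.
have hG k (x : T) : abs (G x - F k x) <= 4 * K * 2^-1 ^+ k.
  apply: le_trans (abs_le _) _; rewrite !reimE /=.
  by have := hu x k; have := hv x k; lra.
exists G => // x; apply/cvgC_abs => e e0.
have e2 : 0 < e / 2 by rewrite divr_gt0.
have [k hk] := half_expn_lt (8 * K) e2.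
have := cF k x => /cvgC_abs/(_ (e / 2)); move=> /(_ e2).
apply: filterS => y hy.
have h1 := abs_dist (G x) (F k x) (G y); have h2 := abs_dist (F k x) (F k y) (G y).
by have := hG k x; have := hG k y; rewrite absB; lra.
Qed.

Definition clamp (t : R) : R := Num.max 0 (Num.min 1 t).

Lemma clamp01 t : 0 <= clamp t <= 1.
Proof. by rewrite /clamp le_max lexx /= ge_max ler01 ge_min lexx. Qed.

Lemma clamp_le0 t : t <= 0 -> clamp t = 0.
Proof. by move=> t0; rewrite /clamp min_r ?max_l// (le_trans t0). Qed.

Lemma clamp_ge1 t : 1 <= t -> clamp t = 1.
Proof. by move=> t0; rewrite /clamp min_l ?max_r. Qed.

Lemma clamp_id t : 0 <= t <= 1 -> clamp t = t.
Proof. by move=> /andP[t0 t1]; rewrite /clamp min_r ?max_r. Qed.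

Lemma continuous_clamp : continuous clamp.
Proof.
move=> t; apply: (@continuous_max R R (cst 0) (fun t => Num.min 1 t)); first exact: cst_continuous.
by apply: (@continuous_min R R (cst 1) id); [exact: cst_continuous|exact: cvg_id].
Qed.

Lemma continuous_affine (a b : R) : continuous (fun t : R => a + b * t).
Proof.
move=> t; apply: continuousD; first exact: cst_continuous.
by apply: continuousM; [exact: cst_continuous|exact: cvg_id].
Qed.

(* The parameter ranges over all of [R]; a path on [0, 1] is extended by constants. *)
Definition joined A z w := exists g : R -> C,
  [/\ continuous g, g 0 = z, g 1 = w & forall t, A (g t)].

Lemma joined_sub A B z w : A `<=` B -> joined A z w -> joined B z w.
Proof. by move=> AB [g [cg g0 g1 gA]]; exists g; split=> // t; apply: AB. Qed.

Lemma joined_refl A z : A z -> joined A z z.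
Proof. by move=> Az; exists (cst z); split => //; exact: cst_continuous. Qed.

Lemma joined_curve A (g : R -> C) (s u : R) : continuous g ->
  (forall t, Num.min s u <= t <= Num.max s u -> A (g t)) -> joined A (g s) (g u).
Proof.
move=> cg gA; exists (fun t => g (s + (u - s) * clamp t)); split.
- move=> t; apply: (@continuous_comp _ _ _ clamp (fun t => g (s + (u - s) * t))).
    exact: continuous_clamp.
  apply: (@continuous_comp _ _ _ (fun t => s + (u - s) * t) g); last exact: cg.
  exact: continuous_affine.
- by rewrite clamp_id ?lexx ?ler01// mulr0 addr0.
- by rewrite clamp_id ?lexx ?ler01// mulr1 addrC subrK.
- move=> t; apply: gA; have /andP[] := clamp01 t; move: (clamp t) => c c0 c1.
  rewrite ge_min le_max; have [su|us] := leP s u.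
    by apply/andP; split; apply/orP; [left|right]; nra.
  by apply/andP; split; apply/orP; [right|left]; nra.
Qed.

Lemma joined_sym A z w : joined A z w -> joined A w z.
Proof.
by move=> [g [cg <- <- gA]]; apply: joined_curve.
Qed.

Lemma joined_trans A z w u : joined A z w -> joined A w u -> joined A z u.
Proof.
move=> [g [cg g0 g1 gA]] [h [ch h0 h1 hA]].
(* At each time one of the two clamped paths rests at [w], so the sum minus [w] is the concatenation
   and is visibly continuous. *)
exists (fun t : R => g (clamp (0 + 2 * t)) + h (clamp (- 1 + 2 * t)) - w); split.
- have ca : continuous (fun t : R => g (clamp (0 + 2 * t))).
    move=> t; apply: (@continuous_comp _ _ _ (fun t : R => 0 + 2 * t) (g \o clamp)); first exact: continuous_affine.
    by apply: continuous_comp; [exact: continuous_clamp|exact: cg].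
  have cb : continuous (fun t : R => h (clamp (- 1 + 2 * t))).
    move=> t; apply: (@continuous_comp _ _ _ (fun t : R => - 1 + 2 * t) (h \o clamp)); first exact: continuous_affine.
    by apply: continuous_comp; [exact: continuous_clamp|exact: ch].
  move=> t; exact: continuousCD (continuousCD (ca t) (cb t)) (@cst_continuous _ _ (- w) t).
- by rewrite !clamp_le0 ?g0 ?h0 ?addrK//; lra.
- by rewrite !clamp_ge1 ?g1 ?h1 1?addrC ?addKr//; lra.
- move=> t; have [t2|t2] := leP t (2^-1).
    by rewrite [clamp (- 1 + _)]clamp_le0 ?h0 ?addrK//; lra.
  by rewrite [clamp (0 + _)]clamp_ge1 ?g1 1?[w + _]addrC ?addrK//; lra.
Qed.

Lemma joined_image A B (f : C -> C) z w :
  (forall z, A z -> {for z, continuous f}) -> (forall z, A z -> B (f z)) ->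
  joined A z w -> joined B (f z) (f w).
Proof.
move=> cf fAB [g [cg <- <- gA]]; exists (f \o g); split.
- by move=> t; apply: continuous_comp; [exact: cg|exact/cf/gA].
- by [].
- by [].
- by move=> t; exact/fAB/gA.
Qed.

Lemma continuous_horizontal (y : R) : continuous (fun t : R => t +i* y).
Proof.
move=> t; apply: continuous_complex => /=; [exact: cvg_id|exact: cst_continuous].
Qed.

Lemma continuous_vertical (x : R) : continuous (fun t : R => x +i* t).
Proof.
move=> t; apply: continuous_complex => /=; [exact: cst_continuous|exact: cvg_id].
Qed.

Lemma joined_horizontal A (y s u : R) :
  (forall t, Num.min s u <= t <= Num.max s u -> A (t +i* y)) ->
  joined A (s +i* y) (u +i* y).
Proof. by apply: (joined_curve (g := fun t => t +i* y)); exact: continuous_horizontal. Qed.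

Lemma joined_vertical A (x s u : R) :
  (forall t, Num.min s u <= t <= Num.max s u -> A (x +i* t)) ->
  joined A (x +i* s) (x +i* u).
Proof. by apply: (joined_curve (g := fun t => x +i* t)); exact: continuous_vertical. Qed.

Lemma joined_segment A z w :
  (forall t : R, 0 <= t <= 1 -> A (z + t%:C * (w - z))) -> joined A z w.
Proof.
move=> h; have -> : z = z + (0 : R)%:C * (w - z) by rewrite mul0r addr0.
have {2}-> : w = z + (1 : R)%:C * (w - z) by rewrite mul1r addrC subrK.
apply: (joined_curve (g := fun t : R => z + t%:C * (w - z))); last first.
  by move=> t; rewrite min_l// max_r//; exact: h.
move=> t; have ct := continuousCM (@continuous_horizontal 0 t) (@cst_continuous _ _ (w - z) t).
exact: continuousCD (@cst_continuous _ _ z t) ct.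
Qed.

End Topology.

(** * Concatenation of infinitely many paths shrinking to a point *)

Section InfiniteConcatenation.
Context {R : realType}.
Local Notation C := R[i].
Implicit Types (z w : C) (A : set C).
Local Notation re := (@complex.Re R).
Local Notation im := (@complex.Im R).

Lemma abs_half_eq (K : R) z w : (forall k, abs (z - w) <= K * 2^-1 ^+ k) -> z = w.
Proof.
move=> h; apply/eqP; rewrite -subr_eq0; apply/eqP/abs_eq0/le_anti.
rewrite abs_ge0 andbT; apply: (@le_half_lim R K) => k.
by rewrite add0r.
Qed.

Lemma half_expn_leD (k m : nat) : (2^-1 : R) ^+ (k + m) <= 2^-1 ^+ m.
Proof.
by rewrite exprD ler_piMl ?exprn_ge0// exprn_ile1// invf_le1// ler1n.
Qed.

(* The m-th path is run on the time interval [1 - 2^-m, 1 - 2^-(m+1)]. *)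
Lemma joined_limit A (K : R) (q : nat -> C) z : A z ->
  (forall m, joined [set w | A w /\ abs (w - z) <= K * 2^-1 ^+ m] (q m) (q m.+1)) ->
  joined A (q 0%N) z.
Proof.
move=> Az /choice[d hd].
have dc m : continuous (d m) by case: (hd m).
have d0 m : d m 0 = q m by case: (hd m).
have d1 m : d m 1 = q m.+1 by case: (hd m).
have dA m t : A (d m t) by case: (hd m) => _ _ _ /(_ t)[].
have dK m t : abs (d m t - z) <= K * 2^-1 ^+ m by case: (hd m) => _ _ _ /(_ t)[].
pose s m (t : R) : R := (2 - 2 ^+ m.+1) + 2 ^+ m.+1 * t.
(* Adding up increments makes [F M] run through the first [M] paths and then rest at [q M]; the m-th
   increment is at most [2 * K * 2^-1 ^+ m], so the [F M] converge uniformly. *)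
pose F := fix F (M : nat) (t : R) : C :=
  if M is m.+1 then F m t + (d m (clamp (s m t)) - q m) else q 0%N.
have cF M : continuous (F M).
  elim: M => [|M IH]; first exact: cst_continuous.
  have cd : continuous (fun t => d M (clamp (s M t))).
    move=> t; apply: (@continuous_comp _ _ _ (s M) (d M \o clamp)); first exact: continuous_affine.
    by apply: continuous_comp; [exact: continuous_clamp|exact: dc].
  move=> t; exact: continuousCD (IH t) (continuousCD (cd t) (@cst_continuous _ _ (- q M) t)).
have FS M t : abs (F M.+1 t - F M t) <= 2 * K * 2^-1 ^+ M.
  have -> : F M.+1 t - F M t = d M (clamp (s M t)) - q M by rewrite /= addrC addKr.
  have h1 := dK M (clamp (s M t)); have := dK M 0; rewrite d0 => h2.
  by have h3 := abs_dist (d M (clamp (s M t))) z (q M); rewrite [abs (z - _)]absB in h3; lra.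
have [G cG hG] := geometric_limit_continuous cF FS.
pose tau m : R := 1 - 2^-1 ^+ m.
have p2 m : (2 : R) ^+ m * 2^-1 ^+ m = 1 by rewrite exprVn mulfV// expf_neq0.
have sE m t : s m t = 2 ^+ m.+1 * (t - tau m).
  have -> : 2 ^+ m.+1 * (t - tau m) = 2 ^+ m.+1 * t - 2 ^+ m.+1 + 2 * (2 ^+ m * 2^-1 ^+ m).
    by rewrite /tau exprS; ring.
  by rewrite p2 /s; ring.
have tauS m : tau m <= tau m.+1.
  by rewrite lerD2l lerN2; exact: (half_expn_leD 1 m).
have s_ge m t : tau m.+1 <= t -> 1 <= s m t.
  move=> h; rewrite sE.
  apply: (@le_trans _ _ (2 ^+ m.+1 * 2^-1 ^+ m.+1)); first by rewrite p2.
  rewrite ler_wpM2l ?exprn_ge0//; apply: le_trans (lerB h (lexx _)).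
  by rewrite /tau exprS; lra.
have s_le m t : t <= tau m -> s m t <= 0.
  by move=> h; rewrite sE mulr_ge0_le0 ?exprn_ge0// subr_le0.
have F_ge M t : tau M <= t -> F M t = q M.
  elim: M => [//|M IH] h /=.
  rewrite (IH (le_trans (tauS M) h)) (clamp_ge1 (s_ge _ _ h)) d1.
  by rewrite addrC subrK.
have F_le M t : t <= tau M -> F M.+1 t = F M t.
  by move=> h /=; rewrite (clamp_le0 (s_le _ _ h)) d0 subrr addr0.
have F_leD M j t : t <= tau M -> F (j + M)%N t = F M t.
  move=> h; elim: j => [//|j IH]; rewrite addSn F_le; first exact: IH.
  by apply: le_trans h _; rewrite lerD2l lerN2 half_expn_leD.
have FA M t : A (F M t).
  elim: M => [|M IH]; first by rewrite /= -d0.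
  have [/F_le->//|/ltW h] := leP t (tau M).
  by rewrite /= (F_ge _ _ h) addrC subrK.
have G_lt M t : t <= tau M -> G t = F M t.
  move=> h; apply: (@abs_half_eq (4 * (2 * K))) => k.
  rewrite -(F_leD M k t h) ; apply: le_trans (hG _ _) _.
  rewrite ler_wpM2l//; last by rewrite [(k + M)%N]addnC half_expn_leD.
  have := le_trans (abs_ge0 _) (dK 0%N 0); rewrite expr0 mulr1; lra.
have G_ge t : 1 <= t -> G t = z.
  (* Of the factor 9, the distance from [G] to [F k] takes 8 and that from [q k] to [z] takes 1. *)
  move=> h; apply: (@abs_half_eq (9 * K)) => k.
  have h1 := hG k t; rewrite F_ge in h1; last first.
    by apply: le_trans h; rewrite lerBlDr lerDl exprn_ge0.
  have := dK k 0; rewrite d0 => h2; have := abs_dist (G t) (q k) z; lra.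
exists G; split => //.
- by rewrite (G_lt 0%N)//= /tau expr0 subrr.
- exact: G_ge.
- move=> t; have [/G_ge->//|t1] := leP 1 t.
  have t0 : 0 < 1 - t by rewrite subr_gt0.
  have [k hk] := half_expn_lt 1 t0.
  by rewrite (G_lt k) // /tau; lra.
Qed.

End InfiniteConcatenation.

(** * Inverse branches and the basin of the half-plane [re < 0] *)

Section Dynamics.
Context {R : realType} (a : R).
Local Notation C := R[i].
Implicit Types (z w u : C) (x y r : R).
Local Notation re := (@complex.Re R).
Local Notation im := (@complex.Im R).
Local Notation f := (f_exp (a%:C : C)).

Definition basin : set C := [set z | exists n, re (iter n f z) < 0].

Definition escapes : set C :=
  [set z | forall M : R, exists N, forall n, (N <= n)%N -> M < abs (iter n f z)].

Definition good : set C := basin `|` escapes.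

Lemma re_f z : re (f z) = expR (re z) * cos (im z) + a.
Proof. by rewrite /f_exp !reimE. Qed.

Lemma im_f z : im (f z) = expR (re z) * sin (im z).
Proof. by rewrite /f_exp !reimE /= addr0. Qed.

Lemma f_subE z : f z - a%:C = cexp z.
Proof. by rewrite /f_exp addrK. Qed.

Lemma basin_re z : re z < 0 -> basin z.
Proof. by exists 0%N. Qed.

Lemma basin_preimage z : basin (f z) -> basin z.
Proof. by move=> [n h]; exists n.+1; rewrite iterSr. Qed.

Lemma escapes_preimage z : escapes (f z) -> escapes z.
Proof.
move=> h M; have [N hN] := h M; exists N.+1 => -[//|n] Nn.
by rewrite iterSr; apply: hN.
Qed.

Lemma good_preimage z : good (f z) -> good z.
Proof. by move=> [/basin_preimage|/escapes_preimage]; [left|right]. Qed.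

(* When [0 < cos (im u)], [offset u] is the multiple of [2 i pi] for which [u - offset u] has
   imaginary part in ]-pi/2, pi/2[, and [branch u] is the inverse branch of [f] on [a < re]
   with [branch u (f u) = u]. Both are locked because rewriting with [reD] and [imD] would
   otherwise see through the sums. *)
Definition offset u : C := locked (u - clog (cexp u)).

Definition branch u w : C := locked (clog (w - a%:C) + offset u).

Lemma offsetE u : offset u = u - clog (cexp u).
Proof. by rewrite /offset -lock. Qed.

Lemma branchE u w : branch u w = clog (w - a%:C) + offset u.
Proof. by rewrite /branch -lock. Qed.

Lemma re_offset u : re (offset u) = 0.
Proof. by rewrite offsetE !reimE re_clog abs_cexp expRK subrr. Qed.

Lemma cexp_offset u : 0 < cos (im u) -> cexp (offset u) = 1.
Proof.
move=> h; apply: (mulIf (cexp_neq0 (clog (cexp u)))).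
have c0 : 0 < re (cexp u) by rewrite cexpE mulr_gt0 ?expR_gt0.
by rewrite -cexpD offsetE subrK clogK ?mul1r.
Qed.

Lemma offset_cos_sin u : 0 < cos (im u) ->
  cos (im (offset u)) = 1 /\ sin (im (offset u)) = 0.
Proof.
move=> /cexp_offset h; have := congr1 re h; have := congr1 im h.
by rewrite cexpE cexpEi re_offset expR0 !mul1r.
Qed.

Lemma im_offset u : - (pi / 2) < im u - im (offset u) < pi / 2.
Proof.
have := clog_im_bound (cexp u).
by rewrite offsetE imD imN opprD opprK addNKr.
Qed.

Lemma re_branch u w : re (branch u w) = ln (abs (w - a%:C)).
Proof. by rewrite branchE reD re_offset addr0. Qed.

Lemma im_branch u w : - (pi / 2) < im (branch u w) - im (offset u) < pi / 2.
Proof. by rewrite branchE imD addrK clog_im_bound. Qed.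

Lemma branch_f u : branch u (f u) = u.
Proof. by rewrite branchE f_subE offsetE addrC subrK. Qed.

Lemma f_branch u w : 0 < cos (im u) -> a < re w -> f (branch u w) = w.
Proof.
move=> u0 w0; rewrite /f_exp branchE cexpD cexp_offset// mulr1 clogK ?subrK//.
by rewrite !reimE subr_gt0.
Qed.

Lemma branch_sub u w v : branch u w - branch u v = clog (w - a%:C) - clog (v - a%:C).
Proof. by rewrite !branchE opprD addrACA subrr addr0. Qed.

Lemma continuous_branch u w : a < re w -> {for w, continuous (branch u)}.
Proof.
move=> w0; have h : {for w, continuous (fun v : C => v - a%:C)}.
  exact: continuousCD (@cvg_id _ _) (@cst_continuous _ _ (- a%:C) w).
have h2 : {for w, continuous (fun v : C => clog (v - a%:C))}.
  apply: (@continuous_comp _ _ _ (fun v : C => v - a%:C) (@clog R)); first exact: h.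
  by apply: continuous_clog; rewrite !reimE subr_gt0.
rewrite (_ : branch u = fun v => clog (v - a%:C) + offset u).
  exact: continuousCD h2 (@cst_continuous _ _ (offset u) w).
by apply/funext => v; rewrite branchE.
Qed.

Lemma abs_sub_ge w : re w - a <= abs (w - a%:C).
Proof. by apply: le_trans (abs_re _); rewrite !reimE ler_norm. Qed.

Lemma cos_gt0_of_re_f z : a < re (f z) -> 0 < cos (im z).
Proof. by rewrite re_f -ltrBlDr subrr pmulr_rgt0// expR_gt0. Qed.

Hypothesis ha : a <= -1.

Ltac alra := (have := ha; lra).

Lemma basin_cos z : cos (im z) <= 0 -> basin z.
Proof.
move=> h; exists 1%N; change (re (f z) < 0); rewrite re_f.
have : expR (re z) * cos (im z) <= 0 by rewrite mulr_ge0_le0// expR_ge0.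
alra.
Qed.

Lemma not_basin z : ~ basin z -> 0 <= re z /\ 0 < cos (im z).
Proof.
move=> h; split.
  by rewrite leNgt; apply/negP => h1; apply/h/basin_re.
by rewrite ltNge; apply/negP => h1; apply/h/basin_cos.
Qed.

Lemma not_basin_f z : ~ basin z -> ~ basin (f z).
Proof. by move=> h /basin_preimage. Qed.

(** On this half-plane [abs (w - a%:C)] is at least [- a >= 1], so inverse branches can be composed
    indefinitely. *)
Lemma re_branch_ge0 u w : 0 <= re w -> 0 <= re (branch u w).
Proof. by move=> w0; rewrite re_branch ln_ge0//; have := abs_sub_ge w; alra. Qed.

Lemma branch_nonexpanding u (m : R) w v : 0 <= m -> m <= re w -> m <= re v ->
  abs (branch u w - branch u v) <= abs (w - v) / (1 + m).
Proof.
move=> m0 w0 v0; rewrite branch_sub.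
have -> : w - v = (w - a%:C) - (v - a%:C) by rewrite opprB addrA subrK.
by apply: clog_lip_re; rewrite ?reimE /=; alra.
Qed.

(* [1] is the only point of [1 <= re] where [clog] is not locally a contraction;
   one of the two outer quarters of a segment of length at least [r] keeps the distance
   [r / 4] from it. *)
Lemma clog_contraction (r : R) : 0 < r -> exists2 q : R, 0 < q < 1 &
  forall z w, 1 <= re z -> 1 <= re w -> r <= abs (z - w) ->
    abs (clog z - clog w) <= q * abs (z - w).
Proof.
(* A point [v] with [1 <= re v] at distance at least [r / 4] from 1 has squared modulus [abs (v - 1)
   ^+ 2 + 2 * re v - 1 >= m ^+ 2]. *)
move=> r0; pose m := Num.sqrt (1 + (r / 4) ^+ 2).
have r4 : 0 < (r / 4) ^+ 2 by rewrite exprn_gt0// divr_gt0.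
have m1 : 1 < m by rewrite -[X in X < _]sqrtr1 ltr_sqrt; lra.
have mi : 0 < m^-1 < 1 by rewrite invr_gt0 invf_lt1; lra.
exists (3 / 4 + m^-1 / 4); first by lra.
move=> z w z1 w1 zw; set d := z - w.
pose p (t : R) := w + t%:C * d.
have rep t : 0 <= t <= 1 -> 1 <= re (p t).
  move=> /andP[t0 t1]; rewrite /p /d !(reimE, reM) /= mul0r subr0.
  have -> : re w + t * (re z - re w) = (1 - t) * re w + t * re z by ring.
  have : (1 - t) * 1 <= (1 - t) * re w by rewrite ler_wpM2l ?subr_ge0.
  by have := ler_wpM2l t0 z1; lra.
have pB s t : p s - p t = (s - t)%:C * d.
  by rewrite /p opprD addrACA subrr add0r -mulrBl -rmorphB.
have absp s t : abs (p s - p t) = `|s - t| * abs d by rewrite pB absM abs_real.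
have near s t : 0 <= s -> s <= t -> t <= 1 ->
    (forall c, s <= c <= t -> r / 4 <= abs (p c - 1)) ->
    abs (clog (p t) - clog (p s)) <= m^-1 * (t - s) * abs d.
  move=> s0 st t1 h.
  have -> : m^-1 * (t - s) * abs d = abs (p t - p s) / m.
    by rewrite absp ger0_norm ?subr_ge0//; ring.
  apply: clog_lip; first lra.
  - by have := rep t; lra.
  - by have := rep s; lra.
  - move=> c /andP[c0 c1].
    have -> : p s + c%:C * (p t - p s) = p (s + c * (t - s)).
      by rewrite pB /p -addrA mulrA -mulrDl -rmorphM -rmorphD.
    set c' := s + _; have c1' : s <= c' <= t by rewrite /c'; nra.
    rewrite -(ger0_norm (abs_ge0 _)) -sqrtr_sqr ler_sqrt ?sqr_ge0//.
    have := h _ c1' => h1; have h2 := rep c'.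
    have : (r / 4) ^+ 2 <= abs (p c' - 1) ^+ 2.
      by rewrite ler_pXn2r ?nnegrE ?abs_ge0//; lra.
    have {h2} : 1 <= re (p c') by apply: h2; lra.
    move: (p c') => v v1; rewrite !abs_sqr !reimE /= subr0; lra.
have weak s t : 0 <= s -> s <= t -> t <= 1 ->
    abs (clog (p t) - clog (p s)) <= (t - s) * abs d.
  move=> s0 st t1.
  have -> : (t - s) * abs d = abs (p t - p s) / 1.
    by rewrite absp ger0_norm ?subr_ge0// divr1.
  by apply: clog_lip_re => //; apply: rep; lra.
have p0 : p 0 = w by rewrite /p mul0r addr0.
have p1 : p 1 = z by rewrite /p mul1r /d addrC subrK.
have [h|/existsNP[s /not_implyP[hs /negP]]] :=
    pselect (forall c, 0 <= c <= 1 / 4 -> r / 4 <= abs (p c - 1)).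
  have h1 := near 0 (1 / 4) (lexx 0) ltac:(lra) ltac:(lra) h.
  have h2 := weak (1 / 4) 1 ltac:(lra) ltac:(lra) (lexx 1).
  have h3 := abs_dist (clog (p 1)) (clog (p (1 / 4))) (clog (p 0)).
  rewrite p0 p1 in h1 h2 h3; apply: (le_trans h3).
  by move: (m^-1) h1 => i h1; lra.
rewrite -ltNge => ps.
(* The point [p s] of the first quarter is within [r / 4] of 1, and the last quarter is at distance
   at least [r / 2] from [p s]. *)
have h : forall c, 3 / 4 <= c <= 1 -> r / 4 <= abs (p c - 1).
  move=> c hc; have := abs_dist (p c) 1 (p s); rewrite absp [abs (1 - _)]absB.
  rewrite ger0_norm ?subr_ge0; last lra.
  have : 1 / 2 * abs d <= (c - s) * abs d by rewrite ler_wpM2r ?abs_ge0//; lra.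
  by rewrite -/d in zw; lra.
have h1 := near (3 / 4) 1 ltac:(lra) ltac:(lra) (lexx 1) h.
have h2 := weak 0 (3 / 4) (lexx 0) ltac:(lra) ltac:(lra).
have h3 := abs_dist (clog (p 1)) (clog (p (3 / 4))) (clog (p 0)).
rewrite p0 p1 in h1 h2 h3; apply: (le_trans h3).
by move: (m^-1) h1 => i h1; lra.
Qed.

End Dynamics.

(** * Density and path-connectedness of the basin *)

Section Basin.
Context {R : realType} (a : R).
Hypothesis ha : a <= -1.
Local Notation C := R[i].
Implicit Types (z w u : C) (x y r : R).
Local Notation re := (@complex.Re R).
Local Notation im := (@complex.Im R).
Local Notation f := (f_exp (a%:C : C)).
Local Notation basin := (basin a).
Local Notation branch := (branch a).
Ltac alra := (have := ha; lra).

Lemma basin_opp_line x y : cos y = -1 -> basin (x +i* y).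
Proof. by move=> cy; apply: (basin_cos ha); rewrite /= cy; lra. Qed.

Lemma cos_offset_pi u : 0 < cos (im u) -> cos (im (offset u) + pi) = -1.
Proof. by move=> /offset_cos_sin[c s]; rewrite cosDpi c. Qed.

(** Only the part of the disc in [0 <= re] is constrained, since a growing disc reaches the
    half-plane re < 0, which lies in the basin. *)
Definition empty_halfdisc z r :=
  0 <= re z /\ forall w, 0 <= re w -> abs (w - z) < r -> ~ basin w.

Lemma empty_halfdisc_center z r : 0 < r -> empty_halfdisc z r -> ~ basin z.
Proof. by move=> r0 [z0]; apply; rewrite // subrr abs0. Qed.

(** A point outside the basin is within [3 * pi / 2 < 6] of a horizontal line contained in the
    basin. *)
Lemma empty_halfdisc_bounded z r : empty_halfdisc z r -> r <= 8.
Proof.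
move=> h; rewrite leNgt; apply/negP => r8; have r0 : 0 < r by lra.
have /(not_basin ha)[z0 /cos_offset_pi c] := empty_halfdisc_center r0 h.
apply: (h.2 (re z +i* (im (offset z) + pi))) => //; last exact: basin_opp_line.
apply: le_lt_trans r8; apply: le_trans (abs_le _) _.
rewrite !reimE /= subrr normr0 add0r ler_norml.
have /andP[h1 h2] := im_offset z; have h3 := @pihalf_lt2 R.
lra.
Qed.

(* Inverse branches map the half-disc around [f z] into the one around [z] and contract. *)
Lemma empty_halfdisc_step (r : R) : 0 < r -> exists2 q : R, 0 < q < 1 &
  forall z s, r <= s -> empty_halfdisc z s -> empty_halfdisc (f z) (s / q).
Proof.
move=> r0; have [q q01 hq] := clog_contraction r0; exists q => // z s rs h.
have nz : ~ basin z by apply: empty_halfdisc_center h; lra.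
have [z0 cz] := not_basin ha nz.
have [fz0 _] := not_basin ha (not_basin_f nz).
split => // w w0 wz bw; apply: (h.2 (branch z w)).
- exact: re_branch_ge0.
- rewrite -[X in _ - X](branch_f a z) branch_sub; set p := w - _; set t := f z - _.
  have e : w - f z = p - t by rewrite /p /t opprB addrA subrK.
  have p1 : 1 <= re p by rewrite !reimE /=; alra.
  have t1 : 1 <= re t by rewrite /t reD reN; change (1 <= re (f z) - a); alra.
  have [pt|pt] := ltP (abs (p - t)) r.
    have := @clog_lip_re R 1 p t ltr01 p1 t1; rewrite divr1; lra.
  apply: le_lt_trans (hq _ _ p1 t1 pt) _.
  by rewrite -e mulrC -ltr_pdivlMr//; lra.
- by apply: basin_preimage; rewrite f_branch//; alra.
Qed.

(** A disc missing the basin would yield empty half-discs of radius [r / q ^+ n] around the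
    iterates, which eventually exceeds the bound 8. *)
Lemma basin_dense z r : 0 < r -> exists2 w, abs (w - z) < r & basin w.
Proof.
move=> r0; apply: contrapT => h.
have nb w : abs (w - z) < r -> ~ basin w by move=> hw bw; apply: h; exists w.
have h0 : empty_halfdisc z r.
  split; last by move=> w _; apply: nb.
  by have /(not_basin ha)[] : ~ basin z; [apply: nb; rewrite subrr abs0|].
have [q /andP[q0 q1] hq] := empty_halfdisc_step r0.
(* The second conjunct lets the same [q] serve at every step. *)
have hn n : empty_halfdisc (iter n f z) (r / q ^+ n) /\ r <= r / q ^+ n.
  elim: n => [|n [IH rn]]; first by rewrite expr0 divr1.
  have e : r / q ^+ n.+1 = r / q ^+ n / q by rewrite exprSr invfM mulrA.
  split; first by rewrite e /=; apply: hq.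
  rewrite e; apply: le_trans rn _; rewrite ler_pdivlMr//.
  by rewrite ler_piMr ?divr_ge0 ?exprn_ge0 ?ltW.
have qn n : q ^+ n >= r / 8.
  have := empty_halfdisc_bounded (hn n).1; rewrite ler_pdivrMr ?exprn_gt0//; lra.
have /cvgrPdist_lt/(_ (r / 8)) : q ^+ n @[n --> \oo] --> 0.
  by apply: cvg_expr; rewrite gtr0_norm.
rewrite divr_gt0// => /(_ isT)[N _ /(_ N (leqnn _))] /=.
by rewrite sub0r normrN ger0_norm ?exprn_ge0 ?ltW// ltNge qn.
Qed.

Lemma joined_halfplane z w : re z < 0 -> re w < 0 -> joined basin z w.
Proof.
move=> z0 w0; apply: joined_segment => t /andP[t0 t1]; apply: basin_re.
rewrite !(reimE, reM) /= mul0r subr0.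
have [->|tn] := eqVneq t 0; first by rewrite mul0r addr0.
have {tn}tp : 0 < t by rewrite lt0r tn.
have : (1 - t) * re z <= 0 by rewrite mulr_ge0_le0 ?subr_ge0// ltW.
have : t * re w < 0 by rewrite pmulr_rlt0.
lra.
Qed.

(** As [a < - 2^-1], paths in this set stay in the domain of the inverse branches. *)
Definition strip_basin : set C := [set w | basin w /\ - 2^-1 <= re w].

Local Notation base := ((- 2^-1)%:C : C).

Lemma strip_basin_left z : re z < 0 -> - 2^-1 <= re z -> joined strip_basin z base.
Proof.
move=> z0 z1; apply: joined_segment => t /andP[t0 t1].
have e : re (z + t%:C * (base - z)) = re z - t * (re z + 2^-1).
  by rewrite !(reimE, reM) /= mul0r subr0; ring.
have h : 0 <= t * (re z + 2^-1) by rewrite mulr_ge0//; lra.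
have h1 : t * (re z + 2^-1) <= 1 * (re z + 2^-1) by rewrite ler_wpM2r//; lra.
by split; [apply: basin_re; rewrite e; lra|rewrite e; lra].
Qed.

(** Moving left keeps [re (f _)] negative: it is at most [a] where the cosine is nonpositive, and
    increasing in the real part elsewhere. *)
Lemma strip_basin_f z : re (f z) < 0 -> - 2^-1 <= re z -> joined strip_basin z base.
Proof.
move=> fz z1; have [z0|z0] := ltP (re z) 0; first exact: strip_basin_left.
apply: (@joined_trans _ _ _ (- 2^-1 +i* im z)); last first.
  by apply: strip_basin_left => //=; lra.
move: fz; rewrite re_f; case: z z0 z1 => x y /= x0 x1 fz.
apply: joined_horizontal => t; rewrite min_r// max_l// => /andP[t0 t1].
split => //; exists 1%N; change (re (f (t +i* y)) < 0); rewrite re_f /=.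
have [c|/ltW c] := leP (cos y) 0.
  by have := mulr_ge0_le0 (expR_ge0 t) c; alra.
by apply: le_lt_trans fz; rewrite lerD2r ler_wpM2r// ler_expR.
Qed.

(* The path from [f z] is lifted by an inverse branch, which needs it to stay in [a < re]. *)
Lemma strip_basin_joined n z : re (iter n f z) < 0 -> - 2^-1 <= re z ->
  joined strip_basin z base.
Proof.
elim: n z => [|n IH] z; first exact: strip_basin_left.
rewrite iterSr => hn z1.
have [z0|z0] := ltP (re z) 0; first exact: strip_basin_left.
have [fz|fz] := ltP (re (f z)) 0; first exact: strip_basin_f.
have hf : - 2^-1 <= re (f z) by lra.
have {}IH := IH _ hn hf.
have cz : 0 < cos (im z) by apply: (@cos_gt0_of_re_f R a); alra.
(* Only points already in [re < 0] are moved by the clamping, so it preserves the basin. *)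
pose h w : C := Num.max (- 2^-1) (re (branch z w)) +i* im (branch z w).
have hz : h (f z) = z.
  by rewrite /h branch_f max_r //; case: (z).
have hD w : strip_basin w -> strip_basin (h w).
  move=> [bw w1]; have wa : a < re w by alra.
  split; last by rewrite /h /= le_max lexx.
  have [l|l] := leP (re (branch z w)) (- 2^-1).
    by apply: basin_re; rewrite /h /= max_l//; lra.
  rewrite (_ : h w = branch z w).
    by apply: basin_preimage; rewrite f_branch.
  by rewrite /h max_r ?ltW//; case: (branch z w).
have ch w : strip_basin w -> {for w, continuous h}.
  move=> [_ w1]; have cl : {for w, continuous (branch z)} by apply: continuous_branch; alra.
  have clr : {for w, continuous (fun v => re (branch z v))}.
    by apply: (@continuous_comp _ _ _ (branch z) re) => //; exact: continuous_re.
  have cli : {for w, continuous (fun v => im (branch z v))}.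
    by apply: (@continuous_comp _ _ _ (branch z) im) => //; exact: continuous_im.
  apply: continuous_complex => //.
  exact: (@continuous_max R _ (cst (- 2^-1)) (fun v => re (branch z v)) w (@cst_continuous _ _ _ w) clr).
apply: (@joined_trans _ _ _ (h base)).
  by rewrite -{1}hz; apply: joined_image IH.
have hb : - 2^-1 <= re (h base) by rewrite /h /= le_max lexx.
have [l|l] := leP (re (branch z base)) (- 2^-1).
  by apply: strip_basin_left => //; rewrite /h /= max_l//; lra.
(* Without clamping, [f] sends the endpoint of the lifted path back to [base], which has negative
   real part. *)
apply: strip_basin_f => //.
have -> : h base = branch z base.
  by rewrite /h max_r ?ltW//; case: (branch z base).
by rewrite f_branch//=; alra.
Qed.

Lemma basin_joined z w : basin z -> basin w -> joined basin z w.
Proof.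
have h u : basin u -> joined basin u base.
  move=> [n un]; have [u0|u0] := leP (- 2^-1) (re u).
    by apply: joined_sub (strip_basin_joined un u0) => v [].
  by apply: joined_halfplane => /=; lra.
by move=> /h hz /h hw; exact: joined_trans hz (joined_sym hw).
Qed.

Lemma Fatou_near_basin z : Fatou_set f z ->
  exists2 w, basin w & joined (Fatou_set f) z w.
Proof.
move=> [U [oU cU Uz nU]].
have UF : U `<=` Fatou_set f by move=> v Uv; exists U.
have /nbhs_ballP[e' /real_gt0[ee e0] sU] : nbhs z U by apply: open_nbhs_nbhs.
rewrite {}ee in sU; move: (re e') e0 sU => e e0 sU.
have [w wz bw] := basin_dense z e0; exists w => //.
apply: joined_segment => t /andP[t0 t1]; apply/UF/sU.
rewrite -ball_normE /ball_ /= normE ltcR opprD addNKr absN absM abs_real ger0_norm//.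
by apply: le_lt_trans wz; rewrite ler_piMl ?abs_ge0.
Qed.

End Basin.

(** * The basin lies in the Fatou set *)

Section BasinFatou.
Context {R : realType} (a : R).
Hypothesis ha : a <= -1.
Local Notation C := R[i].
Implicit Types (z w u : C) (x y r : R).
Local Notation re := (@complex.Re R).
Local Notation im := (@complex.Im R).
Local Notation f := (f_exp (a%:C : C)).
Local Notation basin := (basin a).
Ltac alra := (have := ha; lra).

Lemma f_sub z w : f z - f w = cexp z - cexp w.
Proof. by rewrite /f_exp opprD addrACA subrr addr0. Qed.

Definition in_disc z := abs (z - a%:C) <= 1.

Lemma in_disc_re z : in_disc z -> re z <= a + 1.
Proof.
have := abs_re (z - a%:C); rewrite !reimE /= => h1 h2.
by have := ler_norm (re z - a); rewrite /in_disc in h2; lra.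
Qed.

Lemma f_in_disc z : re z <= 0 -> in_disc (f z).
Proof. by move=> z0; rewrite /in_disc f_subE abs_cexp expR_le1. Qed.

Lemma iter_in_disc n z : in_disc z -> in_disc (iter n f z).
Proof.
elim: n => //= n IH /IH/in_disc_re h; apply: f_in_disc; alra.
Qed.

Lemma f_nonexpanding z w : in_disc z -> in_disc w -> abs (f z - f w) <= abs (z - w).
Proof.
move=> /in_disc_re z1 /in_disc_re w1.
have := @cexp_lip _ 0 z w; rewrite expR0 mul1r f_sub; apply; alra.
Qed.

(* The midpoint of two points of the disc at distance [e] lies in [re <= - e^2 / 8], where
   [f] contracts strictly, even if [a = -1] and the disc touches the imaginary axis. *)
Lemma f_contraction (e : R) : 0 < e -> exists2 q : R, 0 < q < 1 &
  forall z w, in_disc z -> in_disc w -> e <= abs (z - w) ->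
    abs (f z - f w) <= q * abs (z - w).
Proof.
move=> e0; pose d := e ^+ 2 / 8.
have d0 : 0 < d by rewrite divr_gt0// exprn_gt0.
have E0 := expR_gt0 (- d); have E1 : expR (- d) < 1 by rewrite expR_lt1; lra.
exists ((expR (- d) + 1) / 2); first lra.
move=> z w; wlog zw : z w / re z <= re w => [H|zD wD ezw].
  have [/H//|/ltW h zD wD ezw] := leP (re z) (re w).
  by rewrite absB (absB z); apply: H => //; rewrite absB.
pose m : C := (2^-1)%:C * (z + w).
have rem : re m = (re z + re w) / 2 by rewrite reM reD /= mul0r subr0 mulrC.
have imm : im m = (im z + im w) / 2 by rewrite imM imD /= mul0r addr0 mulrC.
have zm : abs (z - m) = abs (z - w) / 2.
  have -> : z - m = (2^-1)%:C * (z - w).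
    by apply: complex_ext; rewrite /m !(reD, reN, reM, imD, imN, imM) /=; lra.
  by rewrite absM abs_real ger0_norm// mulrC.
have mw : abs (m - w) = abs (z - w) / 2.
  have -> : m - w = (2^-1)%:C * (z - w).
    by apply: complex_ext; rewrite /m !(reD, reN, reM, imD, imN, imM) /=; lra.
  by rewrite absM abs_real ger0_norm// mulrC.
(* By the parallelogram law the squared distance from [m] to [a] is at most [1 - e ^+ 2 / 4]. As
   [re z <= re w], the half of the segment from [z] to [m] then lies where the Lipschitz constant is
   [expR (- d)]. *)
have md : re m <= - d.
  have hz : abs (z - a%:C) ^+ 2 <= 1 by rewrite exprn_ile1// abs_ge0.
  have hw : abs (w - a%:C) ^+ 2 <= 1 by rewrite exprn_ile1// abs_ge0.
  have hd : e ^+ 2 <= abs (z - w) ^+ 2 by rewrite ler_pXn2r ?nnegrE ?abs_ge0 ?(ltW e0).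
  rewrite !abs_sqr !reimE /= in hz hw hd; rewrite rem /d.
  have i0 := sqr_ge0 ((im z + im w) / 2).
  have : ((re z + re w) / 2 - a) ^+ 2 <= 1 - e ^+ 2 / 4 by lra.
  set X := (re z + re w) / 2 - a => hX.
  have : X <= 1 - e ^+ 2 / 8 by have := sqr_ge0 (X - 1); lra.
  by rewrite /X; alra.
have w1 := in_disc_re wD.
have h1 := @cexp_lip _ (- d) z m; have h2 := @cexp_lip _ 0 m w.
have h3 := abs_dist (cexp z) (cexp m) (cexp w).
rewrite expR0 mul1r in h2; rewrite zm in h1; rewrite mw in h2.
rewrite f_sub; apply: (le_trans h3).
apply: (le_trans (lerD (h1 _ _) (h2 _ _))); try alra.
Qed.

(** While two orbits are at least [e] apart their distance shrinks by a fixed factor; once closer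
    they remain so, as [f] does not expand on the disc. *)
Lemma orbits_merge (e : R) : 0 < e -> exists N, forall n z w, (N <= n)%N ->
  in_disc z -> in_disc w -> abs (iter n f z - iter n f w) < e.
Proof.
move=> e0; have [q /andP[q0 q1] hq] := f_contraction e0.
have /cvgrPdist_lt/(_ (e / 2)) : q ^+ n @[n --> \oo] --> 0.
  by apply: cvg_expr; rewrite gtr0_norm.
rewrite divr_gt0// => /(_ isT)[N _ hN]; exists N => n z w Nn zD wD.
have h : abs (iter n f z - iter n f w) < e \/
    abs (iter n f z - iter n f w) <= 2 * q ^+ n.
  elim: n {Nn} => [|n IH].
    right; rewrite expr0 mulr1 /=; apply: le_trans (abs_dist _ a%:C _) _.
    by rewrite [X in _ + X]absB; rewrite /in_disc in zD wD; lra.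
  have zn := iter_in_disc n zD; have wn := iter_in_disc n wD.
  have hne := f_nonexpanding zn wn.
  have [lt|ge] := ltP (abs (iter n f z - iter n f w)) e.
    by left; apply: le_lt_trans lt.
  right; rewrite exprS mulrCA; apply: le_trans (hq _ _ zn wn ge) _.
  rewrite ler_wpM2l ?(ltW q0)//; case: IH => // lt.
  by rewrite ltNge ge in lt.
case: h => // h; apply: le_lt_trans h _.
by have := hN n Nn; rewrite /= sub0r normrN ger0_norm ?exprn_ge0 ?ltW//; lra.
Qed.

(** This point is the limit of all orbits in the basin: attracting for [a < -1], parabolic and equal
    to 0 for [a = -1]. *)
Lemma fixed_point : exists2 p : R, f p%:C = p%:C & in_disc p%:C.
Proof.
pose g x := expR x + a - x.
have cg : continuous g.
  move=> x; have cx : {for x, continuous (@id R)} by exact: cvg_id.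
  exact: continuousB (continuousD (@continuous_expR R x) (@cst_continuous _ _ a x)) cx.
have [p] : exists2 p, p \in `[a, 0] & g p = 0.
  apply: IVT; [alra|exact: continuous_subspaceT|].
  have ga : 0 < g a by rewrite /g; have := expR_gt0 a; lra.
  have g0 : g 0 <= 0 by rewrite /g expR0; alra.
  by rewrite min_r ?max_l; [rewrite g0 ltW|lra|lra].
rewrite in_itv /= => /andP[p1 p2] gp.
have fp : f p%:C = p%:C.
  by rewrite /f_exp cexp_real -rmorphD; congr (_%:C); rewrite /g in gp; lra.
by exists p => //; rewrite -fp; apply: f_in_disc.
Qed.

Lemma uniform_cvg_abs (F : set_system (C -> C)) {FF : Filter F} (K : set C) (g : C -> C) :
  (forall e : R, 0 < e -> \forall h \near F, forall z, K z -> abs (g z - h z) < e) ->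
  {uniform K, F --> g}.
Proof.
move=> H P /uniform_nbhs[E [entE sub]].
move: entE; rewrite -entourage_ballE => -[e' /= /real_gt0[ee e0] sE].
rewrite {}ee in sE.
apply: filterS (H _ e0) => h hh; apply: sub => z Kz; apply: sE => /=.
by rewrite -ball_normE /ball_ /= normE ltcR; apply: hh.
Qed.

Lemma ball_connected z (e : R) : 0 < e -> connected (ball z e%:C).
Proof.
move=> e0; have -> : ball z e%:C = \bigcup_(w in ball z e%:C)
    ((fun t : R => z + t%:C * (w - z)) @` `[0, 1]).
  rewrite eqEsubset; split=> w.
    move=> hw; exists w => //; exists 1; first by rewrite /= in_itv /= ler01 lexx.
    by rewrite mul1r addrC subrK.
  move=> [v]; rewrite -ball_normE /ball_ /= normE ltcR => hv [t].
  rewrite in_itv /= => /andP[t0 t1] <-.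
  rewrite normE ltcR opprD addNKr absN absM abs_real ger0_norm//.
  by rewrite absB in hv; apply: le_lt_trans hv; rewrite ler_piMl ?abs_ge0.
apply: bigcup_connected.
  exists z => w _; exists 0; first by rewrite /= in_itv /= ler01 lexx.
  by rewrite mul0r addr0.
move=> w _; apply: connected_continuous_connected; first exact: segment_connected.
apply: continuous_subspaceT => t.
have ct := continuousCM (@continuous_horizontal R 0 t) (@cst_continuous _ _ (w - z) t).
exact: continuousCD (@cst_continuous _ _ z t) ct.
Qed.

Lemma continuous_f : continuous f.
Proof.
move=> z; exact: continuousCD (@continuous_cexp R z) (@cst_continuous _ _ a%:C z).
Qed.

Lemma continuous_iter_f n : continuous (iter n f).
Proof.
elim: n => [|n IH] z; first exact: cvg_id.
by apply: (@continuous_comp _ _ _ (iter n f) f); [exact: IH|exact: continuous_f].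
Qed.

(** In a sequence of iterates of orders [k n], either one order recurs infinitely often and gives a
    constant subsequence, or the orders tend to infinity and the whole sequence converges to the
    fixed point. *)
Lemma iterates_normal (U : set C) m : (forall z, U z -> re (iter m f z) < 0) ->
  normal_family U (iterates f).
Proof.
move=> hU h hh.
have /choice[k hk] : forall n, exists j, h n = iter j f.
  by move=> n; have [j _ <-] := hh n; exists j.
have [[k0 hk0]|nrep] := pselect (exists k0, forall N, exists n, (N <= n)%N /\ k n = k0).
  have /choice[s hs] := hk0.
  pose phi := fix phi j := if j is i.+1 then s (phi i).+1 else s 0%N.
  have kphi j : k (phi j) = k0 by case: j => [|j]; [case: (hs 0%N)|case: (hs (phi j).+1)].
  exists phi; split.
    by apply: homo_ltn => [y x w|i] /=; [exact: ltn_trans|case: (hs (phi i).+1)].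
  left; exists (iter k0 f); apply/fam_cvgP => K _.
  apply: uniform_cvg_abs => e e0; exists 0%N => // n _ z _ /=.
  by rewrite hk kphi subrr abs0.
have kinf K : exists N, forall n, (N <= n)%N -> (K <= k n)%N.
  elim: K => [|K [N hN]]; first by exists 0%N.
  have /existsNP[M /forallNP hM] : ~ (forall N, exists n, (N <= n)%N /\ k n = K).
    by move=> H; apply: nrep; exists K.
  exists (maxn N M) => n; rewrite geq_max => /andP[Nn Mn].
  rewrite ltn_neqAle hN// andbT; apply/eqP => e.
  by apply: (hM n); split.
exists id; split => //; left.
have [p fp pD] := fixed_point.
exists (cst p%:C); apply/fam_cvgP => K [_ KU].
apply: uniform_cvg_abs => e e0.
have [N hN] := orbits_merge e0; have [M hM] := kinf (N + m.+1)%N.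
exists M => // n /= Mn z /KU/hU zU; rewrite hk.
have := hM n Mn; move: (k n) => i Ni.
(* After [m.+1] iterations the points of [U] are in D(a, 1), and at least [N] iterations remain. *)
have -> : i = ((i - m.+1) + m.+1)%N by rewrite subnK// (leq_trans _ Ni)// leq_addl.
rewrite iterD absB; have pn j : p%:C = iter j f p%:C by elim: j => //= j <-.
rewrite (pn (i - m.+1)%N); apply: hN => //.
  by rewrite leq_subRL ?(leq_trans _ Ni) ?leq_addl// addnC.
by rewrite iterS; apply/f_in_disc/ltW.
Qed.

Lemma basin_Fatou z : basin z -> Fatou_set f z.
Proof.
move=> [m zm].
have oV : open [set w | re (iter m f w) < 0].
  apply: (@open_comp _ _ (fun w => re (iter m f w)) [set x | x < 0]); last exact: open_lt.
  move=> w _; apply: (@continuous_comp _ _ _ (iter m f) re); last exact: continuous_re.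
  exact: continuous_iter_f.
have /nbhs_ballP[e' /real_gt0[ee e0] sU] : nbhs z [set w | re (iter m f w) < 0].
  by apply: open_nbhs_nbhs.
rewrite {}ee in sU.
exists (ball z (re e')%:C); split.
- exact: ball_open.
- exact: ball_connected.
- by apply: ballxx; rewrite ltcR.
- by apply: (@iterates_normal _ m) => w /sU.
Qed.

Lemma escapesP z : escapes a z <-> escaping_set f z.
Proof.
split=> [h P [M [/complex_realP[k ->] hM]]|h M].
  have [N hN] := h k; exists N => // n Nn.
  by apply: hM; rewrite normE ltcR; exact: hN.
have [] := h [set w | M%:C < w].
  exists M%:C; split => //; exact/complex_realP/ex_intro.
move=> N _ hN; exists N => n Nn; have := hN n Nn.
by rewrite /= normE ltcR.
Qed.

End BasinFatou.

(** * Curves of escaping and basin points across all horizontal strips *)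

Section SquareModel.
Context {R : realType}.
Local Notation C := R[i].
Implicit Types (z w u : C) (x y r : R).
Local Notation re := (@complex.Re R).
Local Notation im := (@complex.Im R).

Lemma cos_opp_near x : 0 <= x -> exists y, [/\ x <= y, y <= x + 12 & cos y = -1].
Proof.
move=> x0; have p0 := @pi_gt0 R; have p4 : (pi : R) < 4 by have := @pihalf_lt2 R; lra.
have /truncn_itv : 0 <= x / (pi *+ 2) by rewrite divr_ge0// mulrn_wge0// ltW.
set n := Num.trunc _; have p2 : 0 < (pi : R) *+ 2 by rewrite pmulrn_lgt0.
rewrite ler_pdivlMr// ltr_pdivrMr// => /andP[n1 n2].
(* This point lies between [x + pi] and [x + 3 * pi], and [pi < 4] gives the 12. *)
exists (pi + pi *+ 2 *+ n.+1); split.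
- by move: n2; rewrite mulr_natl; lra.
- by move: n1; rewrite mulr_natl mulrSr; lra.
- have per : periodic (@cos R) (pi *+ 2) by exact: cosD2pi.
  by rewrite (periodicn per) cospi.
Qed.

(* [cexp z] has modulus [exp (re z)]; multiplied by [squaring (im z)] it lies on the square
   [max |re| |im| = exp (re z)]. *)
Definition squaring y : R := (Num.max `|cos y| `|sin y|)^-1.

Lemma max_cos_sin y : 2 / 3 <= Num.max `|cos y| `|sin y| <= 1.
Proof.
rewrite le_max ge_max cos_max sin_max andbT.
have [//|h1] := leP (2 / 3) `|cos y|; have [//|h2] := leP (2 / 3) `|sin y|.
have := cos2Dsin2 y; rewrite -(real_normK (num_real (cos y))) -(real_normK (num_real (sin y))).
have := normr_ge0 (cos y); have := normr_ge0 (sin y).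
by move: `|cos y| `|sin y| h1 h2 => s t h1 h2 s0 t0 => h; nra.
Qed.

Lemma squaring_bounds y : 1 <= squaring y <= 3 / 2.
Proof.
have /andP[m1 m2] := max_cos_sin y; have m0 : 0 < Num.max `|cos y| `|sin y| by lra.
rewrite /squaring; apply/andP; split; first by rewrite invf_ge1.
by rewrite -[3 / 2]invrK lef_pV2 ?posrE// ?invr_gt0; lra.
Qed.

Lemma continuous_squaring : continuous squaring.
Proof.
move=> y; have m0 : Num.max `|cos y| `|sin y| != 0.
  by rewrite gt_eqF//; have /andP[m1 m2] := max_cos_sin y; lra.
have cc : {for y, continuous (fun y : R => `|cos y|)}.
  by apply: (@continuous_comp _ _ _ (@cos R) Num.norm); [exact: continuous_cos|exact: norm_continuous].
have cs : {for y, continuous (fun y : R => `|sin y|)}.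
  by apply: (@continuous_comp _ _ _ (@sin R) Num.norm); [exact: continuous_sin|exact: norm_continuous].
have cm : {for y, continuous (fun y : R => Num.max `|cos y| `|sin y|)}.
  exact: (@continuous_max R _ (fun y : R => `|cos y|) (fun y : R => `|sin y|) y cc cs).
exact: (@continuousV R _ (fun y : R => Num.max `|cos y| `|sin y|) y m0 cm).
Qed.

Lemma squaring_cases y :
  [\/ squaring y * cos y = 1, squaring y * cos y = -1,
      squaring y * sin y = 1 | squaring y * sin y = -1].
Proof.
have /andP[m1 _] := max_cos_sin y; rewrite /squaring.
have E x : 2 / 3 <= `|x| -> `|x|^-1 * x = 1 \/ `|x|^-1 * x = -1.
  have [x0|x0] := leP 0 x => h.
    by left; rewrite ger0_norm// in h *; rewrite mulVf// gt_eqF//; lra.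
  by right; rewrite ltr0_norm// invrN mulNr mulVf// lt_eqF.
have [h|h] := leP `|sin y| `|cos y|.
  by rewrite (max_l h) in m1 *; case: (E _ m1); [constructor 1|constructor 2].
by rewrite (max_r (ltW h)) in m1 *; case: (E _ m1); [constructor 3|constructor 4].
Qed.

End SquareModel.

(** * The semiconjugacy from the square exponentials to [f] *)

Section Crossing.
Context {R : realType} (a : R).
Hypothesis ha : a <= -1.
Local Notation C := R[i].
Implicit Types (z w u v : C) (x y r : R).
Local Notation re := (@complex.Re R).
Local Notation im := (@complex.Im R).
Local Notation f := (f_exp (a%:C : C)).
Local Notation basin := (basin a).
Ltac alra := (have := ha; lra).

(** Chosen so that [1 + far <= expR far] yields both bounds of [expR_far]: with 80, [kappa] is at
    most [1 + 12 / 80]; with [4 * (2 - a)], the perturbation in [correction_arg] is at most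
    [1 / 4]. *)
Definition far : R := 88 - 4 * a.

Lemma expR_far : 80 <= expR far /\ 4 * (2 - a) <= expR far.
Proof. by have := expR_ge1Dx far; rewrite /far; split; alra. Qed.

Variable c : nat -> R.
Hypothesis c_far : forall n, far + 1 <= c n.
Hypothesis c_cos : forall n, cos (c n) = -1.
Hypothesis c_exp : forall n, expR (c n) <= c n.+1 <= expR (c n) + 12.

Definition kappa n : R := c n.+1 / expR (c n).

Lemma kappa_bounds n : 1 <= kappa n <= 23 / 20.
Proof.
have /andP[h1 h2] := c_exp n; have e0 := expR_gt0 (c n).
have e1 : expR far <= expR (c n) by rewrite ler_expR; have := c_far n; lra.
have [e2 _] := expR_far.
by rewrite /kappa ler_pdivlMr// ler_pdivrMr//; apply/andP; split; lra.
Qed.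

(* [kappa] makes [model n] map the line [re = c n] to squares whose horizontal sides lie on
   lines of height an odd multiple of [pi], hence in the basin, and whose right side lies on
   the line [re = c n.+1]. *)
Definition model n w : C := (kappa n * squaring (im w))%:C * cexp w.

Definition right_part w : C := Num.max far (re w) +i* im w.

Definition cutoff w : R := clamp (re w - far).

(** Writing [q] for [right_part w], the point [q + correction w v] is the preimage of [v] under [f]
    near [q]; [clog] is applied only near the real interval [1, 7/4], so no choice of branch
    arises. *)
Definition correction w v : C :=
  clog ((v - a%:C) * cexp (- right_part w)).

(** Multiplying [model n q] by [cexp (- q)] leaves the real number [k = kappa n * squaring (im q)]
    of [1, 7/4]; replacing the model by [v - a] moves this by at most [(2 - a) / expR far]. *)
Lemma correction_arg n w v : abs (v - model n (right_part w)) <= 2 ->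
  [/\ 3 / 4 <= re ((v - a%:C) * cexp (- right_part w))
    & abs ((v - a%:C) * cexp (- right_part w) - 1) <= 1].
Proof.
move=> hv; set q := right_part w in hv *.
have [e1 e2] := expR_far; have e0 := expR_gt0 far.
have Eq : abs (cexp (- q)) <= (expR far)^-1.
  by rewrite abs_cexp reN -expRN ler_expR lerN2 /q /= le_max lexx.
set k := kappa n * squaring (im q).
have /andP[k1 k2] : 1 <= k <= 7 / 4.
  have /andP[a1 a2] := kappa_bounds n; have /andP[b1 b2] := squaring_bounds (im q).
  by rewrite /k; apply/andP; split; nra.
set z := _ * cexp _.
have hz : abs (z - k%:C) <= 1 / 4.
  have -> : z - k%:C = (v - model n q - a%:C) * cexp (- q).
    rewrite /z /model -/k !mulrBl -mulrA -cexpD subrr cexp0 mulr1; ring.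
  rewrite absM; apply: (@le_trans _ _ ((2 - a) * (expR far)^-1)); last first.
    by rewrite ler_pdivrMr//; lra.
  apply: ler_pM; rewrite ?abs_ge0//.
  apply: le_trans (abs_tri _ _) _; rewrite absN abs_real ler0_norm; alra.
have := abs_re (z - k%:C); rewrite !reimE [re k%:C]/= ler_norml => /andP[h1 h2].
split; first lra.
have e3 : abs (k%:C - 1) = k - 1.
  rewrite -[X in _ - X]/((1 : R)%:C) -rmorphB abs_real ger0_norm//; lra.
have := abs_dist z k%:C 1; rewrite e3; lra.
Qed.

(** The bound 2 reproduces itself: a displacement of at most 2 at level [n.+1] lifts to one of at
    most 2 at level [n]. *)
Lemma correction_bound n w v : abs (v - model n (right_part w)) <= 2 ->
  abs (correction w v) <= 2.
Proof.
move=> /correction_arg[]; rewrite /correction; set z := _ * cexp _ => z1 z2.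
have c1 : clog (1 : C) = 0.
  apply: complex_ext; last by rewrite /= mul0r atan0.
  by rewrite re_clog (abs_real 1) normr1 ln1.
have := @clog_lip_re R (3 / 4) z 1; rewrite c1 subr0 /=.
have h : (0 : R) < 3 / 4 by lra.
have h1 : 3 / 4 <= (1 : R) by lra.
move=> /(_ h z1 h1) h2; apply: le_trans h2 _; rewrite ler_pdivrMr//; lra.
Qed.

Lemma correction_lip n w v v' : abs (v - model n (right_part w)) <= 2 ->
  abs (v' - model n (right_part w)) <= 2 ->
  abs (correction w v - correction w v') <= 2^-1 * abs (v - v').
Proof.
move=> /correction_arg[z1 _] /correction_arg[z2 _].
have h : (0 : R) < 3 / 4 by lra.
apply: le_trans (clog_lip_re h z1 z2) _.
have -> : (v - a%:C) * cexp (- right_part w) - (v' - a%:C) * cexp (- right_part w)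
  = (v - v') * cexp (- right_part w) by ring.
rewrite absM ler_pdivrMr//.
have e1 : abs (cexp (- right_part w)) <= 1 / 4.
  rewrite abs_cexp reN expRN div1r lef_pV2 ?posrE ?expR_gt0//.
  apply: (@le_trans _ _ (expR far)); last by rewrite ler_expR /= le_max lexx.
  have [e _] := expR_far; lra.
have := ler_wpM2l (abs_ge0 (v - v')) e1; have := abs_ge0 (v - v'); lra.
Qed.

Fixpoint approx k n w : C :=
  if k is j.+1 then
    w + (cutoff w)%:C * correction w (approx j n.+1 (model n (right_part w)))
  else w.

Lemma cutoff01 w : 0 <= cutoff w <= 1.
Proof. exact: clamp01. Qed.

Lemma abs_cutoff w z : abs ((cutoff w)%:C * z) <= abs z.
Proof.
have /andP[l0 l1] := cutoff01 w.
by rewrite absM abs_real ger0_norm// ler_piMl ?abs_ge0.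
Qed.

Lemma approx_near k n w : abs (approx k n w - w) <= 2.
Proof.
elim: k n w => [|k IH] n w; first by rewrite /= subrr abs0.
rewrite /= addrC addKr; apply: le_trans (abs_cutoff _ _) _.
exact: (@correction_bound n).
Qed.

Lemma approx_cauchy k n w : abs (approx k.+1 n w - approx k n w) <= 2 * 2^-1 ^+ k.
Proof.
elim: k n w => [|k IH] n w; first by rewrite expr0 mulr1; exact: (approx_near 1).
have -> : approx k.+2 n w - approx k.+1 n w = (cutoff w)%:C *
    (correction w (approx k.+1 n.+1 (model n (right_part w)))
     - correction w (approx k n.+1 (model n (right_part w)))).
  by rewrite mulrBr [LHS]/= opprD addrACA subrr add0r.
apply: le_trans (abs_cutoff _ _) _.
apply: le_trans (@correction_lip n w _ _ (approx_near _ _ _) (approx_near _ _ _)) _.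
by rewrite exprS mulrCA ler_wpM2l.
Qed.

Lemma continuous_model n : continuous (model n).
Proof.
move=> w; apply: (@continuousCM R _ (fun w : C => (kappa n * squaring (im w))%:C) (@cexp R)); last exact: continuous_cexp.
apply: continuous_complex; last exact: cst_continuous.
apply: (@continuousM R _ (cst (kappa n)) (fun w : C => squaring (im w)) w); first exact: cst_continuous.
by apply: (@continuous_comp _ _ _ im squaring); [exact: continuous_im|exact: continuous_squaring].
Qed.

Lemma continuous_right_part : continuous right_part.
Proof.
move=> w; apply: continuous_complex; last exact: continuous_im.
exact: (@continuous_max R _ (cst far) re w (@cst_continuous _ _ _ w) (@continuous_re R w)).
Qed.

Lemma continuous_cutoff : continuous cutoff.
Proof.
move=> w; apply: (@continuous_comp _ _ _ (fun w => re w - far) clamp); last exact: continuous_clamp.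
exact: continuousB (@continuous_re R w) (@cst_continuous _ _ far w).
Qed.

Lemma continuous_approx k n : continuous (approx k n).
Proof.
elim: k n => [|k IH] n w; first exact: cvg_id.
have cm : {for w, continuous (fun w => approx k n.+1 (model n (right_part w)))}.
  apply: (@continuous_comp _ _ _ right_part (approx k n.+1 \o model n)); first exact: continuous_right_part.
  by apply: continuous_comp; [exact: continuous_model|exact: IH].
have ce : {for w, continuous (fun w => cexp (- right_part w))}.
  apply: (@continuous_comp _ _ _ right_part (fun w => cexp (- w))); first exact: continuous_right_part.
  apply: (@continuous_comp _ _ _ -%R (@cexp R)); last exact: continuous_cexp.
  exact: (@continuousN R[i] R[i] _ id _ (@cvg_id _ _)).
have cc : {for w, continuous (fun w => correction w (approx k n.+1 (model n (right_part w))))}.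
  apply: (@continuous_comp _ _ _ (fun w => (approx k n.+1 (model n (right_part w)) - a%:C)
    * cexp (- right_part w)) (@clog R)).
    exact: continuousCM (continuousCD cm (@cst_continuous _ _ (- a%:C) w)) ce.
  apply: continuous_clog.
  by have [h _] := correction_arg (approx_near k n.+1 (model n (right_part w))); lra.
have cl : {for w, continuous (fun w => (cutoff w)%:C)}.
  by apply: continuous_complex; [exact: continuous_cutoff|exact: cst_continuous].
exact: (continuousCD (@cvg_id _ (nbhs w)) (continuousCM cl cc)).
Qed.

(* [conj] is the limit of lifting the identity through [f] and [model]; by [conj_f] below it
   semiconjugates [model] to [f] level by level. The cutoff makes it the identity far to the
   left, which is needed because [model] leaves the half-plane where [clog] can be applied. *)
Lemma semiconjugacy : exists conj : nat -> C -> C, [/\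
  forall n, continuous (conj n),
  forall n w, abs (conj n w - w) <= 2 &
  forall n w, conj n w =
    w + (cutoff w)%:C * correction w (conj n.+1 (model n (right_part w)))].
Proof.
have /choice[conj hconj] : forall n, exists G : C -> C, continuous G /\
    forall k w, abs (G w - approx k n w) <= 4 * 2 * 2^-1 ^+ k.
  move=> n; have [G cG hG] := geometric_limit_continuous
    (fun k => @continuous_approx k n) (fun k => @approx_cauchy k n).
  by exists G.
have near n w : abs (conj n w - w) <= 2.
  apply: (@le_half_lim R (4 * 2)) => k.
  have h := (hconj n).2 k w; have h1 := approx_near k n w.
  by have h2 := abs_dist (conj n w) (approx k n w) w; lra.
exists conj; split => // [n|n w]; first exact: (hconj n).1.
(* The approximation error of [conj n] at order [k.+1] and the lifted error of [conj n.+1] at order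
   [k] are each at most half of [8 * 2^-1 ^+ k]. *)
apply: (@abs_half_eq R (4 * 2)) => k.
set v := model n (right_part w).
apply: le_trans (abs_dist _ (approx k.+1 n w) _) _.
have h1 := (hconj n).2 k.+1 w.
have h2 : abs (approx k.+1 n w - (w + (cutoff w)%:C * correction w (conj n.+1 v)))
    <= 2^-1 * abs (conj n.+1 v - approx k n.+1 v).
  rewrite [in X in _ <= X]absB /= -/v opprD addrACA subrr add0r -mulrBr.
  apply: le_trans (abs_cutoff _ _) _.
  by apply: (@correction_lip n w); [exact: approx_near|exact: near].
have h3 := (hconj n.+1).2 k v.
by move: h1; rewrite exprS; lra.
Qed.

Section Conj.
Variable conj : nat -> C -> C.
Hypothesis conj_near : forall n w, abs (conj n w - w) <= 2.
Hypothesis conjE : forall n w, conj n w =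
  w + (cutoff w)%:C * correction w (conj n.+1 (model n (right_part w))).

Lemma conj_id n w : re w <= far -> conj n w = w.
Proof.
by move=> h; rewrite conjE /cutoff clamp_le0 ?mul0r ?addr0// subr_le0.
Qed.

Lemma conj_f n w : far + 1 <= re w -> f (conj n w) = conj n.+1 (model n w).
Proof.
move=> h; have rw : right_part w = w.
  by rewrite /right_part max_r; [case: (w)|lra].
have near := conj_near n.+1 (model n w).
rewrite {1}conjE /cutoff clamp_ge1; last lra.
rewrite mul1r /f_exp cexpD /correction clogK.
  by rewrite rw mulrCA -cexpD subrr cexp0 mulr1 subrK.
have [] := @correction_arg n w (conj n.+1 (model n w)); first by rewrite rw.
by rewrite rw; lra.
Qed.

(** On such a line [model] takes negative real values, where the next [conj] is the identity, so the
    logarithm defining the correction is real. *)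
Lemma conj_im n w : cos (im w) = -1 -> im (conj n w) = im w.
Proof.
move=> cw; have sw : sin (im w) = 0 by apply: cos1sin0; rewrite cw normrN1.
rewrite conjE imD; set q := right_part w.
have [k1 _] := andP (kappa_bounds n); have [s1 _] := andP (squaring_bounds (im q)).
set v := model n q; have e0 := expR_gt0 (re q).
have imv : im v = 0 by rewrite imM cexpE cexpEi /= sw mulr0 mul0r mulr0 addr0.
have rev : re v <= far.
  rewrite reM cexpE /= cw mul0r subr0 /far mulrN1 mulrN.
  have : 0 <= kappa n * squaring (im q) * expR (re q).
    by rewrite mulr_ge0 ?(ltW e0)// mulr_ge0; lra.
  by move: (_ * _ * _) => t; alra.
have imz : im ((v - a%:C) * cexp (- q)) = 0.
  rewrite imM imD imv imN cexpEi imN /q /= sinN sw; ring.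
have ic : im (correction w v) = 0.
  by rewrite -[LHS]/(atan (im ((v - a%:C) * cexp (- q)) / re ((v - a%:C) * cexp (- q))))
    imz mul0r atan0.
by rewrite conj_id// imM ic mulr0 add0r mul0r addr0.
Qed.

(** [conj] cannot move the three unwanted sides out of the basin: it fixes the left side and
    preserves heights on the horizontal ones. *)
Lemma conj_step n w : re w = c n -> basin (conj n w) \/
  exists2 w', re w' = c n.+1 & f (conj n w) = conj n.+1 w'.
Proof.
move=> rew; have hf := @conj_f n w; rewrite rew in hf; have {}hf := hf (c_far n).
have e0 := expR_gt0 (c n).
have rem : re (model n w) = c n.+1 * (squaring (im w) * cos (im w)).
  rewrite reM cexpE /= rew mul0r subr0 /kappa.
  by move: (expR _) e0 (squaring _) => e e0 s; field; rewrite gt_eqF.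
have imm : im (model n w) = c n.+1 * (squaring (im w) * sin (im w)).
  rewrite imM cexpEi /= rew mul0r addr0 /kappa.
  by move: (expR _) e0 (squaring _) => e e0 s; field; rewrite gt_eqF.
have line : cos (im (model n w)) = -1 -> basin (conj n w).
  move=> h; apply: basin_preimage; rewrite hf; apply: (basin_cos ha).
  by rewrite conj_im// h lerN10.
have cp : 0 < c n.+1 by have := c_far n.+1; rewrite /far; alra.
case: (squaring_cases (im w)) => h; rewrite h in rem imm.
- by right; exists (model n w); rewrite ?rem ?mulr1.
- left; apply: basin_preimage; rewrite hf conj_id ?rem ?mulrN1; last first.
    by rewrite /far; alra.
  by apply: basin_re; rewrite rem mulrN1 oppr_lt0.
- by left; apply: line; rewrite imm mulr1 c_cos.
- by left; apply: line; rewrite imm mulrN1 cosN c_cos.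
Qed.

Lemma conj_good w : re w = c 0%N -> good a (conj 0%N w).
Proof.
move=> rew; have [|nb] := pselect (basin (conj 0%N w)); first by left.
right; have orbit n : exists2 w', re w' = c n & iter n f (conj 0%N w) = conj n w'.
  elim: n => [|n [w' rw' hw']]; first by exists w.
  have [bw|[w'' rw'' e]] := conj_step rw'; last by exists w'' => //=; rewrite hw'.
  by exfalso; apply: nb; move: bw => [m]; rewrite -hw' -iterD; exists (m + n)%N.
have cn n : n%:R + 3 <= c n.
  elim: n => [|n IH]; first by have := c_far 0%N; rewrite /far; alra.
  have := expR_ge1Dx (c n); have /andP[h _] := c_exp n.
  by rewrite -natr1; lra.
move=> M; exists (Num.bound `|M|) => n Mn.
have [w' rw' ->] := orbit n.
have h := le_trans (ler_norm _) (le_trans (abs_re (w' - conj n w')) _).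
have {h} := h _ (_ : _ <= 2); rewrite absB conj_near => /(_ isT).
rewrite !reimE rw' => h; have h2 := le_trans (ler_norm _) (abs_re (conj n w')).
have h3 : `|M| < n%:R.
  by apply: lt_le_trans (archi_boundP (normr_ge0 M)) _; rewrite ler_nat.
by have := cn n; have := ler_norm M; lra.
Qed.

End Conj.
End Crossing.

Section CrossingCurve.
Context {R : realType} (a : R).
Hypothesis ha : a <= -1.
Local Notation C := R[i].
Local Notation re := (@complex.Re R).
Local Notation im := (@complex.Im R).

(** The last property allows entering and leaving the curve exactly along horizontal lines of the
    basin. *)
Lemma crossing_curve (c0 : R) : far a + 1 <= c0 -> cos c0 = -1 ->
  exists g : R -> C, [/\ continuous g, forall t, good a (g t),
    forall t, abs (g t - (c0 +i* t)) <= 2 &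
    forall t, cos t = -1 -> im (g t) = t].
Proof.
move=> c0far c0cos.
have /choice[s hs] : forall x : R, exists y, [/\ expR x <= y, y <= expR x + 12 & cos y = -1].
  by move=> x; apply: cos_opp_near; exact: expR_ge0.
pose c n := iter n s c0.
have c_exp n : expR (c n) <= c n.+1 <= expR (c n) + 12.
  by have [h1 h2 _] := hs (c n); rewrite /= h1 h2.
have c_cos n : cos (c n) = -1 by case: n => //= n; have [] := hs (c n).
have c_far n : far a + 1 <= c n.
  elim: n => // n IH; apply: le_trans IH _.
  have /andP[h _] := c_exp n; apply: le_trans h.
  by have := expR_ge1Dx (c n); lra.
have [conj [cconj near E]] := semiconjugacy ha c_far c_exp.
exists (fun t => conj 0%N (c0 +i* t)); split.
- move=> t; apply: (@continuous_comp _ _ _ (fun t => c0 +i* t) (conj 0%N)); last exact: cconj.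
  exact: continuous_vertical.
- by move=> t; apply: (conj_good ha c_far c_cos c_exp near E).
- by move=> t; exact: near.
- by move=> t ct; exact: (conj_im ha c_far c_exp E).
Qed.

End CrossingCurve.

(** * Paths to escaping points *)

Section EscapingPoint.
Context {R : realType} (a : R).
Hypothesis ha : a <= -1.
Local Notation C := R[i].
Implicit Types (z w u v : C) (x y r : R).
Local Notation re := (@complex.Re R).
Local Notation im := (@complex.Im R).
Local Notation f := (f_exp (a%:C : C)).
Local Notation basin := (basin a).
Local Notation branch := (branch a).
Ltac alra := (have := ha; lra).

(* [im (offset u) + pi] is an odd multiple of [pi], so [opp_point u] lies in the basin. *)
Definition opp_point u : C := re u +i* (im (offset u) + pi).

Lemma opp_point_basin u : 0 < cos (im u) -> basin (opp_point u).
Proof. by move=> /cos_offset_pi h; exact: basin_opp_line. Qed.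

Lemma pi_lt4 : 0 < (pi : R) < 4.
Proof. by have := @pihalf_lt2 R; have := @pi_gt0 R; lra. Qed.

Lemma im_offset_pi u : `|im (offset u) + pi - im u| <= 6.
Proof.
have /andP[h1 h2] := im_offset u; have /andP[p0 p4] := pi_lt4.
by rewrite ler_norml; apply/andP; split; lra.
Qed.

(** The bound on [re] keeps the ring in the domain of the branches; the logarithm turns the bounds
    on the modulus into additive ones. *)
Definition far_ring (r : R) : set C :=
  [set w | [/\ good a w, a + 2^-1 <= re w & r / 2 <= abs (w - a%:C) <= 4 * r]].

Lemma abs_sub_le w : a <= re w -> abs (w - a%:C) <= re w - a + `|im w|.
Proof.
move=> h; apply: le_trans (abs_le _) _; rewrite !reimE /= subr0.
by rewrite ger0_norm// subr_ge0.
Qed.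

(* Right along a line on which [f] is real and negative, along a crossing curve up to a
   height comparable to the distance to [a], and left along another such line: the path stays
   in a ring around [a] of bounded ratio, so its image under a branch has bounded size. *)
Lemma far_ring_path u : 0 < cos (im u) -> 0 <= re u ->
  far a + 20 <= abs (u - a%:C) ->
  exists2 c : R, 0 <= c &
    joined (far_ring (abs (u - a%:C))) (opp_point u) ((a + 2^-1) +i* c).
Proof.
set r := abs _ => cu u0 r_far.
have r20 : 108 - 4 * a <= r by rewrite /far in r_far; lra.
have rea : re u - a <= r by exact: abs_sub_ge.
have imu : `|im u| <= r.
  by apply: le_trans (abs_im (u - a%:C)); rewrite !reimE /= subr0.
(* [c] is both the abscissa of the crossing curve and the height of the line leading back. The
   margin 4 keeps the curve, which strays by at most 2, to the right of [u]; additive constants are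
   absorbed in [4 * r] by [r20]. *)
have [c [c1 c2 cc]] : exists y, [/\ r + 4 <= y, y <= r + 4 + 12 & cos y = -1].
  by apply: cos_opp_near; alra.
have [g [cg gg gnear gline]] : exists g : R -> C, [/\ continuous g, forall t, good a (g t),
    forall t, abs (g t - (c +i* t)) <= 2 & forall t, cos t = -1 -> im (g t) = t].
  by apply: crossing_curve => //; rewrite /far in r_far *; alra.
have gre t : c - 2 <= re (g t) <= c + 2.
  have := le_trans (abs_re _) (gnear t); rewrite reD reN /= ler_norml => /andP[h1 h2].
  by apply/andP; split; lra.
have gim t : `|im (g t)| <= `|t| + 2.
  have := le_trans (abs_im _) (gnear t); rewrite imD imN /= => h.
  by have := ler_normD (im (g t) - t) t; rewrite subrK; lra.
set l := im (offset u) + pi.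
have hl : `|l - im u| <= 6 by exact: im_offset_pi.
have cl : cos l = -1 by exact: cos_offset_pi.
have labs : `|l| <= r + 6.
  by have := ler_normD (l - im u) (im u); rewrite subrK; lra.
exists c; first alra.
have ge : g l = re (g l) +i* l by rewrite -{3}(gline l cl); case: (g l).
have gc : g c = re (g c) +i* c by rewrite -{3}(gline c cc); case: (g c).
have /andP[gl1 gl2] := gre l; have /andP[gc1 gc2] := gre c.
apply: (@joined_trans _ _ _ (g l)).
  rewrite ge; apply: joined_horizontal => t; rewrite min_l ?max_r; try alra.
  move=> /andP[t1 t2]; split; [by left; exact: basin_opp_line|by rewrite /=; alra|].
  have tl : abs (u - a%:C) - 6 <= abs ((t +i* l) - a%:C).
    have h1 : abs ((re u +i* l) - a%:C) <= abs ((t +i* l) - a%:C).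
      rewrite -(ler_pXn2r (n := 2)) ?nnegrE ?abs_ge0// !abs_sqr !reimE /= lerD2r.
      have hu : 0 <= re u - a by alra.
      have ht : 0 <= t - a by alra.
      by rewrite ler_pXn2r ?nnegrE//; lra.
    have h2 := abs_dist u (re u +i* l) a%:C.
    have h3 : abs (u - (re u +i* l)) <= 6.
      apply: le_trans (abs_le _) _; rewrite !reimE /= subrr normr0 add0r.
      by rewrite distrC.
    lra.
  apply/andP; split; first by rewrite -/r in tl; alra.
  clear - ha r20 c2 t1 t2 gl2 labs u0.
  by apply: le_trans (abs_sub_le _) _ => /=; alra.
apply: (@joined_trans _ _ _ (g c)).
  apply: joined_curve => // t tlc.
  have tabs : `|t| <= r + 16.
    move: labs tlc; rewrite !ler_norml ge_min le_max => /andP[l1 l2].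
    clear - ha r20 c1 c2 l1 l2.
    by move=> /andP[/orP[t1|t1] /orP[t2|t2]]; apply/andP; split; alra.
  have /andP[g1 g2] := gre t; have gt := gim t; have ggt := gg t.
  clear - ha r20 c1 c2 g1 g2 gt tabs ggt.
  split; [exact: ggt|alra|apply/andP; split].
    by apply: le_trans (abs_sub_ge _ _); alra.
  by apply: le_trans (abs_sub_le _) _; alra.
clear - ha r20 c1 c2 cc gc gc1 gc2.
rewrite gc; apply: joined_horizontal => t; rewrite min_r ?max_l; try alra.
move=> /andP[t1 t2]; split; [by left; exact: basin_opp_line|by rewrite /=; alra|].
apply/andP; split.
  by apply: le_trans (abs_im _); rewrite !reimE /= subr0 ger0_norm; alra.
by apply: le_trans (abs_sub_le _) _ => /=; rewrite ?ger0_norm; alra.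
Qed.

Definition nearby u : set C :=
  [set w | [/\ good a w, re u - 2 <= re w & abs (w - u) <= 10]].

(** The ring path starting at [opp_point (f u)] is lifted by [branch u]. As its endpoint has height
    [c >= 0], the lift ends in the upper half of the strip of [u]; from there a vertical and a
    horizontal segment in the basin lead to [opp_point u]. *)
Lemma nearby_path u : far a + 20 <= re u -> 0 < cos (im u) ->
  0 <= re (f u) -> 0 < cos (im (f u)) ->
  joined (nearby u) (branch u (opp_point (f u))) (opp_point u).
Proof.
move=> u_far cu fu0 cfu; set r := abs (f u - a%:C).
have rE : r = expR (re u) by rewrite /r f_subE abs_cexp.
have r_far : far a + 20 <= r by rewrite rE; have := expR_ge1Dx (re u); lra.
have [c c0 hj] := far_ring_path cfu fu0 r_far; rewrite -/r in hj.
have /andP[p0 p4] := pi_lt4; have /andP[d1 d2] := im_offset u.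
have r0 : 0 < r by rewrite rE expR_gt0.
have e1 : 2 <= expR 1 :> R by have := expR_ge1Dx (1 : R); lra.
have e2 : 4 <= expR 2 :> R.
  by have -> : 2 = 1 + 1 :> R by []; rewrite expRD; nra.
have near_re w : far_ring r w -> re u - 1 <= re (branch u w) <= re u + 2.
  move=> [_ _ /andP[w1 w2]]; rewrite re_branch.
  have w0 : 0 < abs (w - a%:C) by lra.
  apply/andP; split; rewrite -ler_expR lnK ?posrE//.
    rewrite expRB -rE; apply: le_trans w1.
    by rewrite ler_pM2l// lef_pV2 ?posrE ?expR_gt0.
  by rewrite expRD -rE; apply: le_trans w2 _; rewrite mulrC ler_pM2l.
have nearP w : good a w -> re u - 2 <= re w <= re u + 2 ->
    im (offset u) - pi / 2 <= im w <= im (offset u) + pi -> nearby u w.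
  move=> gw /andP[r1 r2] /andP[i1 i2]; split => //.
  apply: le_trans (abs_le _) _; rewrite !reimE.
  have : `|re w - re u| <= 2 by rewrite ler_norml; apply/andP; split; lra.
  have : `|im w - im u| <= 6 by rewrite ler_norml; apply/andP; split; lra.
  lra.
have image w : far_ring r w -> nearby u (branch u w).
  move=> Tw; have /andP[b1 b2] := near_re w Tw; have [gw w1 _] := Tw.
  have /andP[i1 i2] := im_branch a u w.
  apply: nearP; try (by apply/andP; split; lra).
  by apply: good_preimage; rewrite f_branch//; lra.
have hj' : joined (nearby u) (branch u (opp_point (f u))) (branch u ((a + 2^-1) +i* c)).
  apply: joined_image hj => // w [_ w1 _]; apply: continuous_branch; lra.
clear e1 e2 u_far r_far r0.
set w0 := (a + 2^-1) +i* c in hj hj'; set b := branch u w0 in hj' *.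
have Tw0 : far_ring r w0 by have [g [_ _ <- gA]] := hj.
have /andP[b1 b2] := near_re w0 Tw0; rewrite -/b in b1 b2.
have fb : f b = w0 by rewrite /b f_branch//=; lra.
have cb : expR (re b) * cos (im b) = 2^-1.
  by have := re_f a b; rewrite fb /=; lra.
have sb : expR (re b) * sin (im b) = c by have := im_f a b; rewrite fb.
have ib0 : im (offset u) <= im b.
  rewrite /b branchE imD lerDr.
  have rw : re (w0 - a%:C) = 2^-1 by rewrite reD reN /=; lra.
  have iw : im (w0 - a%:C) = c by rewrite imD imN /= subr0.
  change (0 <= atan (im (w0 - a%:C) / re (w0 - a%:C))); rewrite rw iw -(@atan0 R).
  by apply: le_atan; rewrite divr_ge0.
have /andP[ib1 ib2] := im_branch a u w0; rewrite -/b in ib1 ib2.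
apply: joined_trans hj' _.
clear hj Tw0 fb near_re image fu0 cfu.
apply: (@joined_trans _ _ _ (re b +i* (im (offset u) + pi))); last first.
  apply: joined_horizontal => t; rewrite ge_min le_max => /andP[/orP t1 /orP t2].
  apply: nearP => /=; try (by apply/andP; split; lra).
  by left; apply: (basin_opp_line ha); exact: cos_offset_pi.
rewrite {1}(_ : b = re b +i* im b); last by case: (b).
apply: joined_vertical => t; rewrite min_l ?max_r; try lra.
move=> /andP[t1 t2]; apply: nearP => /=; try (by apply/andP; split; lra).
left; exists 1%N; change (re (f (re b +i* t)) < 0); rewrite re_f /=.
(* Going up by [s = t - im b], an angle in [0, pi], rotates [f b - a = 1/2 + i c] to real part
   [cos s / 2 - c * sin s <= 1 / 2], less than [- a]. *)
have -> : t = im b + (t - im b) by rewrite addrC subrK.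
rewrite cosD mulrBr !mulrA cb sb.
have s0 : 0 <= sin (t - im b) by apply: sin_ge0_pi; apply/andP; split; lra.
have := mulr_ge0 c0 s0; have := cos_le1 (t - im b); alra.
Qed.

Section Orbit.
Variable z : C.
Hypothesis z_nb : ~ basin z.

Local Notation orb m := (iter m f z).

Lemma orbit_not_basin m : ~ basin (orb m).
Proof. by elim: m => //= m; exact: not_basin_f. Qed.

Lemma orbit_re m : 0 <= re (orb m).
Proof. by have [] := not_basin ha (@orbit_not_basin m). Qed.

Lemma orbit_cos m : 0 < cos (im (orb m)).
Proof. by have [] := not_basin ha (@orbit_not_basin m). Qed.

Fixpoint pullback m w : C := if m is j.+1 then pullback j (branch (orb j) w) else w.

Lemma pullback_preimage (P : set C) m w : (forall v, P (f v) -> P v) ->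
  0 <= re w -> P w -> P (pullback m w).
Proof.
move=> hP; elim: m w => //= m IH w w0 Pw; apply: IH; first exact: re_branch_ge0.
by apply: hP; rewrite f_branch//; [exact: orbit_cos|alra].
Qed.

Lemma continuous_pullback m w : 0 <= re w -> {for w, continuous (pullback m)}.
Proof.
elim: m w => [|m IH] w w0; first exact: cvg_id.
apply: (@continuous_comp _ _ _ (branch (orb m)) (pullback m)).
  by apply: continuous_branch; alra.
by apply: IH; exact: re_branch_ge0.
Qed.

Lemma branch_orbit_sub m (k : R) w : 0 <= k -> k <= re w -> k <= re (orb m.+1) ->
  abs (branch (orb m) w - orb m) <= abs (w - orb m.+1) / (1 + k).
Proof.
move=> k0 w0 o0; rewrite -{2}(branch_f a (orb m)).
exact: branch_nonexpanding.
Qed.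

Lemma pullback_near m w : 0 <= re w -> abs (pullback m w - z) <= abs (w - orb m).
Proof.
elim: m w => //= m IH w w0; apply: le_trans (IH _ (re_branch_ge0 ha _ w0)) _.
have := @branch_orbit_sub m 0 w (lexx 0) w0 (orbit_re m.+1).
by rewrite addr0 divr1.
Qed.

(** Within 10 of an orbit point with real part at least 11 the real part is at least 1, so each
    branch after the first [N] halves the distance and the bound 10 persists; the first [N] do not
    expand. *)
Lemma pullback_contraction N : (forall n, (N <= n)%N -> 11 <= re (orb n)) ->
  forall j w, abs (w - orb (N + j)) <= 10 ->
  abs (pullback (N + j) w - z) <= abs (w - orb (N + j)) * 2^-1 ^+ j.
Proof.
move=> hN j w; elim: j w => [|j IH] w hw.
  rewrite addn0 in hw *; rewrite expr0 mulr1; apply: pullback_near.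
  have := hN N (leqnn _); have := le_trans (abs_re _) hw.
  by rewrite reD reN ler_norml => /andP[h1 h2]; lra.
rewrite addnS in hw *; set v := branch (orb (N + j)) w.
have w1 : 1 <= re w.
  have := hN (N + j).+1 (leq_trans (leq_addr j N) (leqnSn _)).
  have := le_trans (abs_re _) hw.
  by rewrite reD reN ler_norml => /andP[h1 h2]; lra.
have o1 : 1 <= re (orb (N + j).+1).
  by have := hN (N + j).+1 (leq_trans (leq_addr j N) (leqnSn _)); lra.
have hv := branch_orbit_sub ler01 w1 o1; rewrite -/v in hv.
have a0 := abs_ge0 (w - orb (N + j).+1).
have hv2 : abs (v - orb (N + j)) <= abs (w - orb (N + j).+1) / 2 by [].
have hv10 : abs (v - orb (N + j)) <= 10 by lra.
rewrite [pullback _ _]/=; apply: le_trans (IH v hv10) _.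
by rewrite exprS mulrA ler_wpM2r// exprn_ge0.
Qed.

Lemma escaping_point_joined : escapes a z -> exists2 w, basin w & joined (good a) w z.
Proof.
move=> ez; have [N hN] : exists N, forall n, (N <= n)%N -> far a + 20 <= re (orb n).
  (* The distance from [f x] to [a] is [expR (re x)], so a large modulus at the next iterate forces
     a large real part now. *)
  have [N hN] := ez (expR (far a + 20) - a); exists N => n Nn.
  rewrite -ler_expR -abs_cexp -(f_subE a).
  have := hN n.+1 (leqW Nn); have := abs_tri (f (orb n) - a%:C) a%:C.
  by rewrite subrK abs_real ler0_norm; [rewrite /=; lra|alra].
have hN11 n : (N <= n)%N -> 11 <= re (orb n).
  by move=> /hN; rewrite /far; alra.
pose q j := pullback (N + j) (opp_point (orb (N + j))).
have q0 : basin (q 0%N).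
  apply: (pullback_preimage (P := basin)); first exact: basin_preimage.
    exact: orbit_re.
  exact/opp_point_basin/orbit_cos.
exists (q 0%N) => //; apply: (@joined_limit _ _ 10); first by right.
move=> j; apply: joined_sym.
have Nj : (N <= N + j)%N := leq_addr j N.
rewrite /q addnS [pullback (N + j).+1 _]/=.
have hp := nearby_path (hN _ Nj) (orbit_cos _) (orbit_re (N + j).+1) (orbit_cos (N + j).+1).
have re0 w : nearby (orb (N + j)) w -> 0 <= re w.
  by move=> [_ w1 _]; have := hN11 _ Nj; lra.
apply: joined_image hp => w hw; first exact/continuous_pullback/re0.
have [gw _ w10] := hw; split.
  apply: (pullback_preimage (P := good a)) => //; last exact: re0.
  exact: good_preimage.
apply: le_trans (pullback_contraction hN11 w10) _.
by rewrite ler_wpM2r// exprn_ge0.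
Qed.

End Orbit.

End EscapingPoint.

Theorem corollary1p4 (R : realType) (a : R) (ha : a <= -1) :
  path_connected R (Fatou_set (f_exp a%:C) `|` escaping_set (f_exp a%:C)).
Proof.
set A := _ `|` _.
have goodA : good a `<=` A.
  by move=> z [/(basin_Fatou ha)|/escapesP]; [left|right].
have basinA : basin a `<=` A by move=> z bz; apply: goodA; left.
have to_basin z : A z -> exists2 w, basin a w & joined A z w.
  move=> [Fz|/escapesP ez].
    have [w bw h] := Fatou_near_basin ha Fz; exists w => //.
    by apply: joined_sub h => v; left.
  have [bz|nbz] := pselect (basin a z).
    by exists z => //; apply/joined_refl/basinA.
  have [w bw h] := escaping_point_joined ha nbz ez; exists w => //.
  exact/joined_sym/(joined_sub goodA).
move=> x y /to_basin[z bz xz] /to_basin[w bw yw].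
have zw := joined_sub basinA (basin_joined ha bz bw).
have [g [cg g0 g1 gA]] := joined_trans xz (joined_trans zw (joined_sym yw)).
by exists g; split => //; exact: continuous_subspaceT.
Qed.
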